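(* Let $G=(V,E)$ be a connected, possibly infinite, simple graph with non-negative Ollivier--Ricci curvature and with all vertex degrees bounded by $d<\infty$. Then for all $x,y\in V$ and $t>0$, \[ D(P_t(x,\cdot)\|P_t(y,\cdot))\le 32d\left(\frac{\mathrm{dist}(x,y)^2}{t}+\frac{\mathrm{dist}(x,y)}{\sqrt t}\right). \] Equivalently, for every bounded function $f:V\to(0,\infty)$, all $x,y\in V$ and $t>0$, \[ P_t\log f(x)\le\log P_tf(y)+32d\left(\frac{\mathrm{dist}(x,y)^2}{t}+\frac{\mathrm{dist}(x,y)}{\sqrt t}\right). \]
   Context: $G=(V,E)$ is a connected, locally finite, simple graph with at least one edge. Its random walk kernel is $P(x,y)=\mathbf 1_{\{x\sim y\}}/\deg(x)$, and the heat semigroup is $P_t=e^{t(P-I)}$, i.e. $P_t(x,y)=e^{-t}\sum_{k\ge0}\frac{t^k}{k!}P^k(x,y)$, with $P_tf(x)=\sum_zP_t(x,z)f(z)$ (the value $-\infty$ is allowed for $P_t\log f(x)$). $\mathrm{dist}$ is the graph distance. $D(\mu\|\nu)=\int\log(d\mu/d\nu)\,d\mu$ if $\mu\ll\nu$ and $+\infty$ otherwise is relative entropy. For probability measures $\mu,\nu$ on $V$, $W_1(\mu,\nu)=\inf_\pi\sum_{u,v\in V}\mathrm{dist}(u,v)\pi(u,v)$, the infimum being over all couplings $\pi$ of $\mu$ and $\nu$. With the lazy kernel $\widehat P=\frac12(I+P)$, $G$ has non-negative Ollivier--Ricci curvature if $W_1(\widehat P(x,\cdot),\widehat P(y,\cdot))\le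 1$ whenever $x\sim y$. *)

(* Defs.v *)
From HB Require Import structures.
From mathcomp Require Import all_boot all_order all_algebra finmap.
From mathcomp Require Import all_classical all_reals all_analysis.

Set Implicit Arguments.
Unset Strict Implicit.
Unset Printing Implicit Defensive.

Import Order.TTheory GRing.Theory Num.Theory.
Import numFieldNormedType.Exports.

Local Open Scope classical_set_scope.
Local Open Scope ring_scope.

(* Edges are unoriented by [adj_sym] and there are no loops by [adj_irr]; the
   vertex type may be finite or infinite. *)
Record lfgraph := LFGraph {
  vertex : Type;
  adj : rel vertex;
  adj_sym : symmetric adj;
  adj_irr : irreflexive adj;
  adj_locfin : forall x, finite_set [set y | adj x y];
  adj_connected : forall x y, exists p, path adj x p /\ last x p = y;
  adj_edge : exists x y, adj x y
}.

HB.instance Definition _ (G : lfgraph) := gen_eqMixin (vertex G).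
HB.instance Definition _ (G : lfgraph) := gen_choiceMixin (vertex G).
HB.instance Definition _ (G : lfgraph) :=
  isPointed.Build (vertex G) (sval (cid (adj_edge G))).

HB.instance Definition _ (G : lfgraph) :=
  @isMeasurable.Build default_measure_display (vertex G)
    discrete_measurable discrete_measurable0 discrete_measurableC
    discrete_measurableU.

Lemma esumZl (R : realType) (T : choiceType) (I : set T) (c : R)
    (a : T -> \bar R) : 0 <= c -> (forall i, (0 <= a i)%E) ->
  (\esum_(i in I) (c%:E * a i) = c%:E * \esum_(i in I) a i)%E.
Proof.
move=> c0 a0; rewrite /esum -ereal_supZl//; last first.
  by apply/set0P; exists (\sum_(i \in set0) a i)%R, set0 => //; exact: fsets_set0.
rewrite image_comp; congr ereal_sup; apply: eq_imagel => A _ /=.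
by rewrite ge0_mule_fsumr.
Qed.

Lemma exchange_esum (R : realType) (S T : choiceType) (I : set S) (J : set T)
    (a : S -> T -> \bar R) : (forall i j, (0 <= a i j)%E) ->
  (\esum_(i in I) \esum_(j in J) a i j =
   \esum_(j in J) \esum_(i in I) a i j)%E.
Proof.
move=> a0; rewrite esum_esum// esum_esum//.
rewrite (@reindex_esum _ _ _ (J `*`` fun=> I) (I `*`` fun=> J)
  (fun k => (k.2, k.1)))//; split.
- by move=> [j i] [].
- by move=> [j i] [j' i'] _ _ [-> ->].
- by move=> [i j] [Ii Jj]; exists (j, i).
Qed.

Section graph.
Variable G : lfgraph.
Implicit Types x y z : vertex G.

Definition deg x : nat := #|` fset_set [set y | adj x y]|.

Definition walk x y (n : nat) : Prop :=
  exists p, [/\ path (@adj G) x p, last x p = y & size p = n].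

Lemma walk_ex x y : exists n, `[< walk x y n >].
Proof.
have [p [px py]] := adj_connected x y.
by exists (size p); apply/asboolP; exists p.
Qed.

Definition gdist x y : nat := ex_minn (walk_ex x y).

Variable R : realType.

(* Probability measures on the vertices are given here by their mass
   functions. *)
Definition coupling (mu nu : vertex G -> R) : set (vertex G * vertex G -> R) :=
  [set pi | [/\ forall p, 0 <= pi p,
    forall u, (\esum_(v in [set: vertex G]) (pi (u, v))%:E = (mu u)%:E)%E &
    forall v, (\esum_(u in [set: vertex G]) (pi (u, v))%:E = (nu v)%:E)%E]].

Definition W1 (mu nu : vertex G -> R) : \bar R :=
  ereal_inf [set (\esum_(p in [set: vertex G * vertex G])
                    ((gdist p.1 p.2)%:R * pi p)%:E)%E | pi in coupling mu nu].

Definition rw x y : R := (adj x y)%:R / (deg x)%:R.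

Definition lazy_rw x y : R := 2^-1 * ((x == y)%:R + rw x y).

Definition nonneg_ollivier_ricci : Prop :=
  forall x y, adj x y -> (W1 (lazy_rw x) (lazy_rw y) <= 1)%E.

(* [rw_pow k x y] is the entry of the [k]-th matrix power of [rw]; the sum over
   [z] has finite support. *)
Fixpoint rw_pow (k : nat) x y : R :=
  if k is k'.+1 then \sum_(z \in [set: vertex G]) rw x z * rw_pow k' z y
  else (x == y)%:R.

Definition heat (t : R) x y : R :=
  expR (- t) * limn (series (fun k => t ^+ k / k`!%:R * rw_pow k x y)).

(* Unordered sum of a family of arbitrary sign; it is [-oo] when only the
   negative parts have infinite sum. *)
Definition sumpn (a : vertex G -> \bar R) : \bar R :=
  (esum [set: vertex G] a^\+ - esum [set: vertex G] a^\-)%E.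

Definition heat_op (t : R) (f : vertex G -> R) x : \bar R :=
  sumpn (fun z => (heat t x z * f z)%:E).

Lemma deg_gt0 x : (0 < deg x)%N.
Proof.
suff [y xy] : exists y, adj x y.
  rewrite /deg cardfs_gt0; apply/fset0Pn; exists y.
  by rewrite in_fset_set ?inE //; exact: adj_locfin.
have [a [b ab]] := adj_edge G.
have [[|c p] [/= xp pa]] := adj_connected x a.
  by exists b; rewrite pa.
by exists c; case/andP: xp.
Qed.

Lemma rw_ge0 x y : 0 <= rw x y.
Proof. by rewrite /rw divr_ge0. Qed.

Lemma rw_pow_ge0 k x y : 0 <= rw_pow k x y.
Proof.
elim: k x y => [x y|k IH x y] /=; first exact: ler0n.
by apply: fsumr_ge0 => z _; rewrite mulr_ge0 ?rw_ge0.
Qed.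

Lemma rw_powSE k x y : (rw_pow k.+1 x y)%:E =
  (\esum_(z in [set z | adj x z]) (rw x z * rw_pow k z y)%:E)%E.
Proof.
have finN : finite_set [set z | adj x z] by exact: adj_locfin.
rewrite /= -(@fsbig_widen _ _ _ _ [set z | adj x z] [set: vertex G])//; last first.
  by move=> z [_ /negP/negPf xz] /=; rewrite /rw xz !mul0r.
rewrite -fsumEFin// esum_fset// => z _.
by rewrite lee_fin mulr_ge0 ?rw_ge0 ?rw_pow_ge0.
Qed.

Lemma rw_mass x : (\esum_(z in [set z | adj x z]) (rw x z)%:E = 1)%E.
Proof.
have finN : finite_set [set z | adj x z] by exact: adj_locfin.
rewrite esum_fset//; last by move=> z _; rewrite lee_fin rw_ge0.
rewrite fsumEFin// fsbig_finite//= (eq_big_seq (fun=> (deg x)%:R^-1)); last first.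
  by move=> z; rewrite in_fset_set// inE /rw /= => ->; rewrite mul1r.
rewrite big_const_seq count_predT iter_addr_0 -[X in X%:E]mulr_natr mulVf//.
by rewrite pnatr_eq0 -lt0n deg_gt0.
Qed.

Lemma rw_pow_mass k x :
  (\esum_(y in [set: vertex G]) (rw_pow k x y)%:E = 1)%E.
Proof.
elim: k x => [|k IH] x.
  rewrite (esumID [set x])//; last by move=> y _; rewrite lee_fin rw_pow_ge0.
  rewrite setTI esum_set1 /= ?lee_fin ?ler0n// eqxx esum1 ?adde0//.
  by move=> y [_ /eqP]; rewrite eq_sym => /negPf ->.
under eq_esum do rewrite rw_powSE.
rewrite exchange_esum; last first.
  by move=> y z; rewrite lee_fin mulr_ge0 ?rw_ge0 ?rw_pow_ge0.
rewrite -[RHS](rw_mass x); apply: eq_esum => z _.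
under eq_esum do rewrite EFinM.
by rewrite esumZl ?rw_ge0 ?IH ?mule1// => y; rewrite lee_fin rw_pow_ge0.
Qed.

Lemma rw_pow_le1 k x y : rw_pow k x y <= 1.
Proof.
rewrite -lee_fin -(rw_pow_mass k x); apply: esum_ge; exists [set y].
  by split.
by rewrite fsbig_set1.
Qed.

Section heat.
Variables (t : R) (t_gt0 : 0 < t).

Let heat_term_ge0 x y k : 0 <= t ^+ k / k`!%:R * rw_pow k x y.
Proof. by rewrite mulr_ge0 ?rw_pow_ge0// divr_ge0// exprn_ge0// ltW. Qed.

Let heat_cvg x y :
  cvgn (series (fun k => t ^+ k / k`!%:R * rw_pow k x y)).
Proof.
apply: series_le_cvg (is_cvg_series_exp_coeff t) => k.
- exact: heat_term_ge0.
- by rewrite divr_ge0// exprn_ge0// ltW.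
- by rewrite ler_piMr ?rw_pow_le1// divr_ge0// exprn_ge0// ltW.
Qed.

Let heatE x y : (heat t x y)%:E = ((expR (- t))%:E *
  \esum_(k in [set: nat]) (t ^+ k / k`!%:R * rw_pow k x y)%:E)%E.
Proof.
rewrite /heat EFinM -(EFin_lim (@heat_cvg x y)); congr (_ * _)%E.
rewrite -nneseries_esumT; last by move=> k; rewrite lee_fin heat_term_ge0.
by apply: congr_lim; apply/funext => n; rewrite /= sumEFin.
Qed.

Lemma heat_ge0 x y : 0 <= heat t x y.
Proof.
rewrite -lee_fin heatE mule_ge0 ?lee_fin ?expR_ge0//.
by apply: esum_ge0 => k _; rewrite lee_fin heat_term_ge0.
Qed.

Lemma heat_mass x : (\esum_(y in [set: vertex G]) (heat t x y)%:E = 1)%E.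
Proof.
under eq_esum do rewrite heatE.
rewrite esumZl ?expR_ge0//; last first.
  by move=> y; apply: esum_ge0 => k _; rewrite lee_fin heat_term_ge0.
rewrite exchange_esum; last by move=> y k; rewrite lee_fin heat_term_ge0.
under eq_esum => k _.
  under eq_esum do rewrite EFinM.
  rewrite esumZl; [|by rewrite divr_ge0// exprn_ge0// ltW|
                   by move=> y; rewrite lee_fin rw_pow_ge0].
  rewrite rw_pow_mass mule1.
  over.
rewrite -nneseries_esumT; last first.
  by move=> k; rewrite lee_fin divr_ge0// exprn_ge0// ltW.
transitivity ((expR (- t))%:E * (expR t)%:E)%E.
  congr (_ * _)%E; rewrite -(EFin_lim (is_cvg_series_exp_coeff t)).
  by apply: congr_lim; apply/funext => n; rewrite /= sumEFin.
by rewrite -EFinM -expRD addNr expR0.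
Qed.

Variable x : vertex G.

(* The probability measure [P_t(x, .)]; the proof of [0 < t] is an argument only
   so that the probability instance below can be inferred. *)
Definition heat_prob of 0 < t := fun A : set (vertex G) =>
  (\esum_(z in A) (heat t x z)%:E)%E.

Let heat_prob0 : heat_prob t_gt0 set0 = 0%E.
Proof. exact: esum_set0. Qed.

Let heat_prob_ge0 A : (0 <= heat_prob t_gt0 A)%E.
Proof. by apply: esum_ge0 => z _; rewrite lee_fin heat_ge0. Qed.

Let heat_prob_sigma_additive : semi_sigma_additive (heat_prob t_gt0).
Proof.
move=> F mF tF mUF; rewrite /heat_prob.
rewrite nneseries_sum_bigcup//; last by move=> z; rewrite lee_fin heat_ge0.
by apply: is_cvg_nneseries => n _ _; exact: heat_prob_ge0.
Qed.

HB.instance Definition _ := isMeasure.Build _ _ _ (heat_prob t_gt0)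
  heat_prob0 heat_prob_ge0 heat_prob_sigma_additive.

HB.instance Definition _ := Measure_isProbability.Build _ _ _
  (heat_prob t_gt0) (heat_mass x).

End heat.

End graph.

Arguments nonneg_ollivier_ricci : clear implicits.

Local Open Scope charge_scope.

Definition rel_entropy (d : measure_display) (T : measurableType d)
    (R : realType) (mu nu : probability T R) : \bar R :=
  if `[< mu `<< nu >] then
    (\int[mu]_z lne (('d (charge_of_finite_measure mu) '/d nu) z))%E
  else +oo%E.

(* Main.v *)
Require Import Defs.
From mathcomp Require Import all_boot all_order all_algebra finmap.
From mathcomp Require Import all_classical all_reals all_analysis.
From mathcomp Require Import ring lra zify.

(** The proof is a maximum principle with doubled space variables.  Put
    [w_s = P_s (log f)] and [u_s = log (P_s f)], with [0 <= log f] bounded.  The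
    function [w] solves the heat equation, while [u] solves it with an extra
    source [sum_z P(y, z) psi(u z - u y)], where [psi a = exp a - 1 - a >= 0].
    The claim is that [w_s x - u_s y] stays below
    [Phi(s, D) = 32 d (D^2 / s + D / sqrt s)], [D = dist(x, y)].  On the
    diagonal this is Jensen's inequality, and off the diagonal it is free for
    [s] close to 0, because [Phi] blows up there.

    Suppose that equality is reached at [(x, y)] with [D > 0], and let [z] be
    the neighbour of [y] that is one step closer to [x].  Comparing [(x, y)]
    with [(x, z)] gives [u z - u y >= Phi(s, D) - Phi(s, D - 1)], so the source
    contributes at least a multiple of the square of that slope, divided by
    [d].  Against it stand the time derivative of [Phi], and the mean change of
    [Phi] under a coupling of two walks started at [x] and [y].  Non-negative
    curvature gives lazy couplings under which the distance does not grow in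
    mean; it moves by at most 2, so the mean change of [Phi] is [O(d / s)].  The
    slope is at least a multiple of [d (D / s + 1 / sqrt s)], and its square
    beats both terms: the summand [D / sqrt s] of [Phi] is there to provide the
    [1 / s] that pays for the jumps even when [D] is small.

    On an infinite graph no maximum need be attained, so time is discretised
    with the Markov operator [f |-> (f + h P f) / (1 + h)].  The inequality then
    passes from each time to the next with no loss, once [h] is small and [d] is
    replaced by [d + h] ([euler_penalty_step]).  In this form the gain from the
    source is the Gibbs variational inequality [gibbs_euler], for the law that
    moves a little mass from [y] to [z], and the coupling is
    [lazy_avg_transport].  The number of steps then tends to infinity
    ([euler_le_semigroup], [semigroup_le_euler]), which gives
    [log_harnack_semigroup] for functions between two positive constants.

    Both parts of the theorem follow by truncation.  For the second, [f] is
    bounded away from 0 by [exp (- L)] and [L] tends to infinity.  For the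
    first, the inequality is applied to the density
    [P_t(x, z) / P_t(y, z)] cut off from above and below. *)

Set Implicit Arguments.
Unset Strict Implicit.
Unset Printing Implicit Defensive.

Import Order.TTheory GRing.Theory Num.Theory.
Import numFieldNormedType.Exports.

Local Open Scope classical_set_scope.
Local Open Scope ring_scope.

(** * The graph distance *)

Section distance.
Variable G : lfgraph.
Implicit Types x y z : vertex G.

Lemma gdist_walk x y : walk x y (gdist x y).
Proof. by rewrite /gdist; case: ex_minnP => n /asboolP. Qed.

Lemma gdist_le x y n : walk x y n -> (gdist x y <= n)%N.
Proof.
by move=> w; rewrite /gdist; case: ex_minnP => m _; apply; apply/asboolP.
Qed.

Lemma walk0 x : walk x x 0.
Proof. by exists [::]. Qed.

Lemma walkS x y z n : adj x y -> walk y z n -> walk x z n.+1.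
Proof.
by move=> xy [p [yp pz <-]]; exists (y :: p); split => //=; rewrite xy.
Qed.

Lemma walk_cat x y z m n : walk x y m -> walk y z n -> walk x z (m + n).
Proof.
move=> [p [xp py <-]] [q [yq qz <-]]; exists (p ++ q).
by split; rewrite ?size_cat// ?cat_path ?last_cat ?py// xp.
Qed.

Lemma walk_sym x y n : walk x y n -> walk y x n.
Proof.
elim: n x => [|n IHn] x [[|z p] [//= xp py sp]]; first by exists [::].
case/andP: xp => xz zp; rewrite -addn1; apply: (@walk_cat y z).
  by apply: IHn; exists p; split => //; case: sp.
by apply: (walkS _ (walk0 x)); rewrite (@adj_sym G).
Qed.

Lemma gdistxx x : gdist x x = 0%N.
Proof. by apply/eqP; rewrite -leqn0; exact: gdist_le (walk0 x). Qed.

Lemma gdist_eq0 x y : gdist x y = 0%N -> x = y.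
Proof. by have [p [_ <- <-]] := gdist_walk x y; move=> /size0nil ->. Qed.

Lemma gdistC x y : gdist x y = gdist y x.
Proof.
by apply/eqP; rewrite eqn_leq !gdist_le//; apply/walk_sym/gdist_walk.
Qed.

Lemma gdist_triangle x y z : (gdist x z <= gdist x y + gdist y z)%N.
Proof. by apply/gdist_le/walk_cat; exact: gdist_walk. Qed.

Lemma gdist_ball x x' y y' : (gdist x x' <= 1)%N -> (gdist y y' <= 1)%N ->
  (gdist x y <= gdist x' y' + 2)%N.
Proof.
move=> xx' yy'.
have := gdist_triangle x x' y; have := gdist_triangle x' y' y.
by rewrite (gdistC y'); lia.
Qed.

Lemma gdist_adj x y : adj x y -> (gdist x y <= 1)%N.
Proof. by move=> xy; apply/gdist_le/(walkS xy)/walk0. Qed.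

Lemma geodesic_step x y n : gdist x y = n.+1 ->
  exists2 z, adj y z & gdist x z = n.
Proof.
move=> xyn; have := gdist_walk y x; rewrite gdistC xyn.
case=> -[|z p] [//= /andP[yz zp] px [sp]]; exists z => //.
apply/eqP; rewrite eqn_leq gdistC gdist_le /=; last by exists p.
by rewrite -ltnS -xyn gdistC; apply/gdist_le/(walkS yz)/gdist_walk.
Qed.

Lemma gdist_le1 x y : (gdist x y <= 1)%N -> y = x \/ adj x y.
Proof.
case E : (gdist x y) => [|[|//]] _; first by left; rewrite (gdist_eq0 E).
by right; have [z yz /gdist_eq0 ->] := geodesic_step E; rewrite (@adj_sym G).
Qed.

End distance.

(** * Neighbourhood averages and the Euler step *)

Section average.
Variables (G : lfgraph) (R : realType).
Implicit Types (x y z : vertex G) (f g : vertex G -> R).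

Definition nbrs x : seq (vertex G) := fset_set [set y | adj x y].

Lemma mem_nbrs x y : (y \in nbrs x) = adj x y.
Proof.
rewrite in_fset_set; last exact: adj_locfin.
by apply/idP/idP => [|h]; rewrite inE.
Qed.

Lemma deg_ge1 x : 1 <= (deg x)%:R :> R.
Proof. by rewrite ler1n deg_gt0. Qed.

Lemma deg_neq0 x : (deg x)%:R != 0 :> R.
Proof. by rewrite pnatr_eq0 -lt0n deg_gt0. Qed.

Definition avg f x : R := (\sum_(y <- nbrs x) f y) / (deg x)%:R.

Lemma avg_le f g x : (forall y, adj x y -> f y <= g y) -> avg f x <= avg g x.
Proof.
move=> fg; rewrite ler_wpM2r// big_seq [leRHS]big_seq.
by apply: ler_sum => y; rewrite mem_nbrs; exact: fg.
Qed.

Lemma avgD f g x : avg (fun y => f y + g y) x = avg f x + avg g x.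
Proof. by rewrite /avg big_split mulrDl. Qed.

Lemma avgZ c f x : avg (fun y => c * f y) x = c * avg f x.
Proof. by rewrite /avg -mulr_sumr mulrA. Qed.

Lemma avg_cst c x : avg (fun=> c) x = c.
Proof.
rewrite /avg big_const_seq count_predT iter_addr_0 -[_ *+ _]mulr_natr -mulrA.
by rewrite mulfV ?mulr1 ?deg_neq0.
Qed.

Lemma avgB f g x : avg (fun y => f y - g y) x = avg f x - avg g x.
Proof.
rewrite avgD; congr (_ + _); rewrite -mulN1r -avgZ; congr avg.
by apply/funext => y; rewrite mulN1r.
Qed.

Lemma avg_delta z (c : R) x : adj x z ->
  avg (fun y => if y == z then c else 0) x = c / (deg x)%:R.
Proof.
move=> xz; rewrite /avg -big_mkcond big_const_seq iter_addr_0.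
by rewrite count_uniq_mem ?fset_uniq// mem_nbrs xz.
Qed.

Lemma avg_sum n (c : nat -> R) (F : nat -> vertex G -> R) x :
  avg (fun y => \sum_(i < n) c i * F i y) x = \sum_(i < n) c i * avg (F i) x.
Proof.
elim: n => [|n IHn].
  rewrite big_ord0 -[RHS](avg_cst 0 x); congr avg.
  by apply/funext => y; rewrite big_ord0.
rewrite big_ord_recr /= -IHn -avgZ -avgD; congr avg.
by apply/funext => y; rewrite big_ord_recr.
Qed.

(** One step, of length [h], of the walk that jumps with probability
    [h / (1 + h)].  Dividing by [1 + h], rather than keeping [1 - h] on the
    diagonal, makes this a Markov operator for every [h >= 0], and makes [n]
    steps a binomial sum with nonnegative terms. *)
Definition euler (h : R) f x : R := (f x + h * avg f x) / (1 + h).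

Lemma eulerE (h : R) f x : 0 <= h -> (1 + h) * euler h f x = f x + h * avg f x.
Proof. by move=> h0; rewrite /euler; field; lra. Qed.

Lemma euler_le (h : R) f g : 0 <= h -> (forall y, f y <= g y) ->
  forall x, euler h f x <= euler h g x.
Proof.
move=> h0 fg x; rewrite ler_wpM2r ?invr_ge0 ?addr_ge0// lerD// ler_wpM2l//.
exact: avg_le.
Qed.

Lemma euler_cst (h c : R) x : 0 <= h -> euler h (fun=> c) x = c.
Proof. by move=> h0; rewrite /euler avg_cst; field; lra. Qed.

Lemma euler_lb (h c : R) f : 0 <= h -> (forall y, c <= f y) ->
  forall x, c <= euler h f x.
Proof. by move=> h0 cf x; rewrite -[leLHS](euler_cst c x h0); exact: euler_le. Qed.

Lemma euler_ub (h c : R) f : 0 <= h -> (forall y, f y <= c) ->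
  forall x, euler h f x <= c.
Proof. by move=> h0 cf x; rewrite -[leRHS](euler_cst c x h0); exact: euler_le. Qed.

Lemma eulerB (h : R) f g x :
  euler h (fun y => f y - g y) x = euler h f x - euler h g x.
Proof. by rewrite /euler avgB; ring. Qed.

Lemma iter_euler_lb (h c : R) f n : 0 <= h -> (forall y, c <= f y) ->
  forall x, c <= iter n (euler h) f x.
Proof. by move=> h0 cf; elim: n => //= n; exact: euler_lb. Qed.

Lemma iter_euler_ub (h c : R) f n : 0 <= h -> (forall y, f y <= c) ->
  forall x, iter n (euler h) f x <= c.
Proof. by move=> h0 cf; elim: n => //= n; exact: euler_ub. Qed.

(** The tangent to [exp] at [ln r], weakened by [ln r <= r - 1]. *)
Lemma expR_ge_tangent (r a : R) : 0 <= r -> r * (2 - r + a) <= expR a.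
Proof.
rewrite le_eqVlt => /predU1P[<-|r0]; first by rewrite mul0r expR_ge0.
have -> : expR a = r * expR (a - ln r).
  by rewrite expRD expRN lnK ?posrE//; field; rewrite gt_eqF.
rewrite ler_wpM2l ?(ltW r0)//; have := expR_ge1Dx (a - ln r).
have : ln r <= r - 1 by have := le_ln1Dx (x := r - 1); rewrite subrKC; apply; lra.
lra.
Qed.

(** The Gibbs variational inequality
    [log (sum_v p v * exp (u v)) >= sum_v q v * u v - chi2(q, p)], where [p] is
    the law of one Euler step from [y], and [q] is [p] with mass
    [h * dl / (1 + h)] moved from [y] to [z].  The first order gain
    [dl * (u z - u y)] against the quadratic cost is the discrete form of the
    source term in the equation of [log P_s f]. *)
Lemma gibbs_euler (h dl : R) (u : vertex G -> R) y z :
  0 < h -> 0 <= dl -> h * dl <= 1 -> adj y z ->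
  euler h u y + h / (1 + h) * (dl * (u z - u y) - dl ^+ 2 * (h + (deg y)%:R))
    <= ln (euler h (fun v => expR (u v)) y).
Proof.
move=> h0 dl0 hdl yz; set m := leLHS.
have D0 := deg_neq0 y; set D := (deg y)%:R : R in D0 m *.
have h1 : 1 + h != 0 by rewrite gt_eqF//; lra.
(* With [r v = q v / p v], the tangent inequality is applied to [u v - m] at
   [r v]; the weighted sum of the lower bounds is exactly 1. *)
suff H : (1 + h) * expR m <= expR (u y) + h * avg (fun v => expR (u v)) y.
  rewrite -ler_expR lnK; first by rewrite /euler ler_pdivlMr 1?mulrC//; lra.
  rewrite posrE (lt_le_trans (expR_gt0 m))//.
  by rewrite /euler ler_pdivlMr 1?mulrC//; lra.
have E v : expR (u v) = expR m * expR (u v - m) by rewrite -expRD subrKC.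
have -> : avg (fun v => expR (u v)) y = expR m * avg (fun v => expR (u v - m)) y.
  by rewrite -avgZ; congr avg; apply/funext.
rewrite (E y) mulrCA -mulrDr [leLHS]mulrC ler_pM2l ?expR_gt0//.
have D_ge0 : 0 <= D by [].
have A : 1 + avg u y - m + (dl * (u z - m) - dl ^+ 2 * D)
    <= avg (fun v => expR (u v - m)) y.
  have -> : 1 + avg u y - m + (dl * (u z - m) - dl ^+ 2 * D) =
    avg (fun v => (1 - m) + u v +
       (if v == z then dl * D * (u z - m) - (dl * D) ^+ 2 else 0)) y.
    rewrite avgD avg_delta// avgD avg_cst -/D.
    have -> : (dl * D * (u z - m) - (dl * D) ^+ 2) / D =
        dl * (u z - m) - dl ^+ 2 * D by field.
    ring.
  apply: avg_le => v _; case: eqP => [->|_]; last first.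
    by have := @expR_ge_tangent 1 (u v - m) ler01; lra.
  have r0 : 0 <= 1 + dl * D by rewrite addr_ge0// mulr_ge0.
  apply: le_trans (expR_ge_tangent (u z - m) r0); rewrite le_eqVlt; apply/orP; left.
  by apply/eqP; ring.
have B := @expR_ge_tangent (1 - h * dl) (u y - m) ltac:(lra).
apply: le_trans (lerD B (ler_wpM2l (ltW h0) A)).
have : (1 + h) * m = u y + h * avg u y
    + h * (dl * (u z - u y) - dl ^+ 2 * (h + D)).
  by rewrite /m /euler; field.
clearbody m => e.
rewrite [leRHS](_ : _ = 1 + h + (u y + h * avg u y
    + h * (dl * (u z - u y) - dl ^+ 2 * (h + D)) - (1 + h) * m)); last by ring.
by rewrite -e subrr addr0.
Qed.

End average.

(** * Curvature and transport of the lazy walk *)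

Section transport.
Variables (G : lfgraph) (R : realType).
Implicit Types (x y z : vertex G) (f g : vertex G -> R).

Lemma esum_delta x f : (forall z, 0 <= f z) ->
  (\esum_(z in [set: vertex G]) ((x == z)%:R * f z)%:E = (f x)%:E)%E.
Proof.
move=> f0; rewrite (esumID [set x])//; last first.
  by move=> z _; rewrite lee_fin mulr_ge0.
rewrite setTI esum_set1 ?eqxx ?mul1r ?lee_fin// esum1 ?adde0//.
by move=> z [_ /eqP]; rewrite eq_sym => /negPf ->; rewrite mul0r.
Qed.

Lemma avg_esum_adj x f : (forall z, 0 <= f z) ->
  ((avg f x)%:E = \esum_(z in [set z | adj x z]) (rw R x z * f z)%:E)%E.
Proof.
move=> f0; have finN : finite_set [set z | adj x z] by exact: adj_locfin.
rewrite esum_fset//; last by move=> z _; rewrite lee_fin mulr_ge0// rw_ge0.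
rewrite fsumEFin// fsbig_finite//=; congr EFin; rewrite /avg mulr_suml.
by apply: eq_big_seq => z; rewrite mem_nbrs /rw mulrC => ->; rewrite mul1r.
Qed.

Lemma avg_esum x f : (forall z, 0 <= f z) ->
  ((avg f x)%:E = \esum_(z in [set: vertex G]) (rw R x z * f z)%:E)%E.
Proof.
move=> f0; rewrite avg_esum_adj// [RHS](esumID [set z | adj x z])//; last first.
  by move=> z _; rewrite lee_fin mulr_ge0// rw_ge0.
rewrite setTI [X in (_ + X)%E]esum1 ?adde0//.
by move=> z [_ /negP/negPf xz] /=; rewrite /rw xz !mul0r.
Qed.

Definition lazy_avg f x : R := (f x + avg f x) / 2.

Lemma lazy_avg_esum x f : (forall z, 0 <= f z) ->
  ((lazy_avg f x)%:E = \esum_(z in [set: vertex G]) (lazy_rw R x z * f z)%:E)%E.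
Proof.
move=> f0; rewrite /lazy_avg mulrC EFinM EFinD avg_esum// -(esum_delta x f0).
rewrite -esumD; [|by move=> z _; rewrite lee_fin mulr_ge0 ?rw_ge0..].
rewrite -esumZl ?invr_ge0//; last first.
  by move=> z; rewrite -EFinD lee_fin addr_ge0// mulr_ge0// rw_ge0.
by apply: eq_esum => z _; rewrite -EFinD -EFinM -mulrDl mulrA.
Qed.

(** The easy half of Kantorovich duality.  The infimum that defines [W1] need
    not be known to be attained, so a coupling of cost less than [1 + e'] is
    used, with [L * e' <= e].  Nonnegativity of [f] keeps all the sums in the
    realm of unordered sums of nonnegative terms. *)
Lemma lazy_avg_lip_adj (L : R) f x y : nonneg_ollivier_ricci G R ->
    0 <= L -> (forall z, 0 <= f z) ->
    (forall u v, f u <= f v + L * (gdist u v)%:R) -> adj x y ->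
  lazy_avg f x <= lazy_avg f y + L.
Proof.
move=> curv L0 f0 lip xy; apply/ler_addgt0Pr => e e0.
have e1 : 0 < e / (L + 1) by rewrite divr_gt0//; lra.
have : (W1 (lazy_rw R x) (lazy_rw R y) < (1 + e / (L + 1))%:E)%E.
  by apply: le_lt_trans (curv _ _ xy) _; rewrite lte_fin; lra.
move=> /ereal_inf_lt[_ [p [p0 px py] <-]] cost.
suff : ((lazy_avg f x)%:E <= (lazy_avg f y)%:E +
    L%:E * (1 + e / (L + 1))%:E)%E.
  rewrite -EFinM -EFinD lee_fin => /le_trans; apply.
  rewrite mulrDr mulr1 -!addrA !lerD2l mulrCA ler_piMr ?(ltW e0)//.
  by rewrite ler_pdivrMr; lra.
have -> : ((lazy_avg f x)%:E = \esum_(u in [set: vertex G])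
    \esum_(v in [set: vertex G]) (f u * p (u, v))%:E)%E.
  rewrite lazy_avg_esum//; apply: eq_esum => u _; rewrite [_ * f u]mulrC EFinM -px.
  by rewrite -esumZl// => v; rewrite lee_fin.
have -> : ((lazy_avg f y)%:E = \esum_(u in [set: vertex G])
    \esum_(v in [set: vertex G]) (f v * p (u, v))%:E)%E.
  rewrite lazy_avg_esum// exchange_esum; last first.
    by move=> u v; rewrite lee_fin mulr_ge0.
  apply: eq_esum => v _; rewrite [_ * f v]mulrC EFinM -py -esumZl// => u.
  by rewrite lee_fin.
apply: le_trans (leeD2l _ (lee_wpmul2l _ (ltW cost))); last by rewrite lee_fin.
rewrite -esumZl//; last by move=> q; rewrite lee_fin mulr_ge0.
have -> : (\esum_(i in [set: vertex G * vertex G])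
    (L%:E * ((gdist i.1 i.2)%:R * p i)%:E) = \esum_(u in [set: vertex G])
    \esum_(v in [set: vertex G]) (L%:E * ((gdist u v)%:R * p (u, v))%:E))%E.
  rewrite esum_esum; last first.
    by move=> u v _ _; rewrite -EFinM lee_fin !mulr_ge0.
  have -> : [set: vertex G] `*`` (fun=> [set: vertex G]) = setT.
    by apply/seteqP; split.
  by apply: eq_esum => -[u v].
rewrite -esumD; first last.
- by move=> u _; apply: esum_ge0 => v _; rewrite -EFinM lee_fin !mulr_ge0.
- by move=> u _; apply: esum_ge0 => v _; rewrite lee_fin mulr_ge0.
apply: le_esum => u _; rewrite -esumD; first last.
- by move=> v _; rewrite -EFinM lee_fin !mulr_ge0.
- by move=> v _; rewrite lee_fin mulr_ge0.
apply: le_esum => v _; rewrite -EFinM -EFinD lee_fin mulrA -mulrDl.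
by rewrite ler_wpM2r.
Qed.

Lemma lazy_avg_lip (L : R) f x y : nonneg_ollivier_ricci G R ->
    0 <= L -> (forall z, 0 <= f z) ->
    (forall u v, f u <= f v + L * (gdist u v)%:R) ->
  lazy_avg f x <= lazy_avg f y + L * (gdist x y)%:R.
Proof.
move=> curv L0 f0 lip; have [p [+ + <-]] := gdist_walk x y.
elim: p x => [x _ <-|z p IHp x /= /andP[xz zp] py]; first by rewrite mulr0 addr0.
apply: le_trans (lazy_avg_lip_adj curv L0 f0 lip xz) _.
by have := IHp _ zp py; rewrite -natr1; lra.
Qed.

(** This stands for a coupling of the lazy steps from [x] and [y] whose mean
    distance is at most [gdist x y], without gluing couplings along a geodesic:
    up to the constant [A], the minimum [f] of the [B]-Lipschitz cones
    [u y' + B * gdist _ y'] with apex [y'] in the unit ball of [y] separates [w]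
    from [u], and the averages of a Lipschitz function are already controlled.
    The hypothesis is local because it is applied to an affine majorant of a
    quadratic cost, which is valid only near [gdist x y]. *)
Lemma lazy_avg_transport (A B : R) (w u : vertex G -> R) x y :
    nonneg_ollivier_ricci G R -> 0 <= B -> (forall z, 0 <= u z) ->
    (forall x' y', (gdist x x' <= 1)%N -> (gdist y y' <= 1)%N ->
      w x' <= u y' + A + B * (gdist x' y')%:R) ->
  lazy_avg w x <= lazy_avg u y + A + B * (gdist x y)%:R.
Proof.
move=> curv B0 u0 wu; pose c z y' := u y' + B * (gdist z y')%:R.
pose f z := \big[Num.min/c z y]_(y' <- nbrs y) c z y'.
have c0 z y' : 0 <= c z y' by rewrite addr_ge0// mulr_ge0.
have f0 z : 0 <= f z by apply: le_bigmin.
have fy z : f z <= c z y by exact: bigmin_le_id.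
have fn z y' : adj y y' -> f z <= c z y'.
  by rewrite -mem_nbrs => yy'; exact: ge_bigmin_seq.
have le_f (a : R) z : (forall y', (gdist y y' <= 1)%N -> a <= c z y') -> a <= f z.
  move=> ac; rewrite /f big_seq; apply: le_bigmin => [|y'].
    by apply: ac; rewrite gdistxx.
  by rewrite mem_nbrs => /gdist_adj /ac.
have lip z z' : f z <= f z' + B * (gdist z z')%:R.
  rewrite -lerBlDr; apply: le_f => y' yy'.
  have : f z <= c z y'.
    by case: (gdist_le1 yy') => [->|]; [exact: fy|exact: fn].
  move=> /le_trans; rewrite lerBlDr; apply; rewrite /c -addrA lerD2l.
  rewrite -mulrDr ler_wpM2l// -natrD ler_nat addnC; exact: gdist_triangle.
have wf : lazy_avg w x <= lazy_avg f x + A.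
  have wf x' : (gdist x x' <= 1)%N -> w x' <= f x' + A.
    move=> xx'; rewrite -lerBlDr; apply: le_f => y' yy'.
    by have := wu _ _ xx' yy'; rewrite /c; lra.
  have := @avg_le _ _ w (fun z => f z + A) x.
  rewrite avgD avg_cst => /(_ (fun z xz => wf z (gdist_adj xz))).
  by have := wf x; rewrite gdistxx => /(_ isT); rewrite /lazy_avg; lra.
have fu : lazy_avg f y <= lazy_avg u y.
  rewrite /lazy_avg ler_wpM2r// lerD//.
    by have := fy y; rewrite /c gdistxx mulr0 addr0.
  by apply: avg_le => z yz; have := fn z z yz; rewrite /c gdistxx mulr0 addr0.
have := lazy_avg_lip x y curv B0 f0 lip; lra.
Qed.

End transport.

(** * The penalty function *)

Section penalty.
Variable R : realType.
Implicit Types (k s h D : R).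

Definition penalty k s D : R := 32 * k * (D ^+ 2 / s + D / Num.sqrt s).

(** The rate at which mass is moved towards the other point.  It optimises
    [drift * slope - k * drift ^ 2] when the slope of the penalty is
    [32 * k * (D / s + 1 / sqrt s)], a lower bound of
    [penalty k s D - penalty k s (D - 1)]. *)
Definition drift s D : R := 16 * (D / s + (Num.sqrt s)^-1).

Lemma drift_ge0 s D : 0 <= s -> 0 <= D -> 0 <= drift s D.
Proof. by move=> s0 D0; rewrite mulr_ge0// addr_ge0// ?divr_ge0// invr_ge0. Qed.

Lemma penalty_ge0 k s D : 0 <= k -> 0 <= s -> 0 <= D -> 0 <= penalty k s D.
Proof.
by move=> k0 s0 D0; rewrite mulr_ge0 ?mulr_ge0// addr_ge0// divr_ge0// sqr_ge0.
Qed.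

Lemma penalty0 k s : penalty k s 0 = 0.
Proof. by rewrite /penalty expr0n !mul0r addr0 mulr0. Qed.

Lemma invE_sqrt s : 0 <= s -> s^-1 = (Num.sqrt s)^-1 ^+ 2.
Proof. by move=> s0; rewrite exprVn sqr_sqrtr. Qed.

(** The scalar inequality that makes the comparison propagate.  With
    [r = 1 / sqrt s] and [a = D r^2 + r], the bracket on the left is at least
    [k (512 a^2 - 256 a^2 - 256 r^2) = 256 k (D^2 r^4 + 2 D r^3)], since the
    [r^2] in [a^2] pays exactly for the jumps.  What is left exceeds the
    decrease of the penalty from time [s] to [s + h]. *)
Lemma penalty_step k s h D : 0 <= k -> 0 < s -> 0 < h -> h <= 1 -> 1 <= D ->
  (1 + h) * penalty k s D
    - h * (drift s D * (penalty k s D - penalty k s (D - 1))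
           - drift s D ^+ 2 * k - 256 * (k / s))
  <= (1 + h) * penalty k (s + h) D.
Proof.
move=> k0 s0 h0 h1 D1; rewrite /penalty /drift.
have sh0 : 0 < s + h by lra.
rewrite (invE_sqrt (ltW s0)) (invE_sqrt (ltW sh0)).
set r := (Num.sqrt s)^-1; set q := (Num.sqrt (s + h))^-1.
have r0 : 0 < r by rewrite invr_gt0 sqrtr_gt0.
have q0 : 0 < q by rewrite invr_gt0 sqrtr_gt0.
have rs : r ^+ 2 * s = 1 by rewrite exprVn sqr_sqrtr ?(ltW s0)// mulVf ?gt_eqF.
have qs : q ^+ 2 * (s + h) = 1.
  by rewrite exprVn sqr_sqrtr ?(ltW sh0)// mulVf ?gt_eqF.
have rq : r ^+ 2 - q ^+ 2 = q ^+ 2 * r ^+ 2 * h.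
  rewrite -[X in X - _]mulr1 -qs -[X in _ - X]mulr1 -rs; ring.
clearbody r q.
have qr : q <= r.
  rewrite -(@ler_pXn2r _ 2) ?nnegrE ?(ltW r0) ?(ltW q0)// -subr_ge0 rq.
  by rewrite !mulr_ge0 ?sqr_ge0// ltW.
have qr2 : q ^+ 2 <= r ^+ 2 by rewrite ler_pXn2r ?nnegrE ?(ltW r0) ?(ltW q0).
have a2 : r ^+ 2 - q ^+ 2 <= h * r ^+ 4.
  rewrite rq (_ : h * r ^+ 4 = r ^+ 2 * r ^+ 2 * h); last by ring.
  by rewrite ler_wpM2r ?(ltW h0)// ler_wpM2r// sqr_ge0.
have a1 : r - q <= h * r ^+ 3.
  rewrite -(ler_pM2l r0) (_ : r * (h * r ^+ 3) = h * r ^+ 4); last by ring.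
  apply: le_trans a2; nra.
have main : (1 + h) * (D ^+ 2 * (r ^+ 2 - q ^+ 2) + D * (r - q))
    <= 8 * h * (D ^+ 2 * r ^+ 4 + 2 * D * r ^+ 3).
  have r3 : 0 <= r ^+ 3 by rewrite exprn_ge0// ltW.
  have r4 : 0 <= r ^+ 4 by rewrite exprn_ge0// ltW.
  have b2 := ler_wpM2l (sqr_ge0 D) a2.
  have D0 : 0 <= D by lra.
  have b1 := ler_wpM2l D0 a1.
  have c : 0 <= D ^+ 2 * (h * r ^+ 4) + D * (h * r ^+ 3).
    by rewrite addr_ge0// !mulr_ge0 ?sqr_ge0// ltW.
  have c1 : 0 <= D * (h * r ^+ 3) by rewrite !mulr_ge0// ltW.
  have c2 : 0 <= D ^+ 2 * (h * r ^+ 4) by rewrite !mulr_ge0 ?sqr_ge0// ltW.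
  apply: (@le_trans _ _ (2 * (D ^+ 2 * (h * r ^+ 4) + D * (h * r ^+ 3)))).
    apply: (@le_trans _ _ ((1 + h) * (D ^+ 2 * (h * r ^+ 4) + D * (h * r ^+ 3)))).
      by rewrite ler_wpM2l; lra.
    by rewrite ler_wpM2r//; lra.
  lra.
have k32 : 0 <= 32 * k by rewrite mulr_ge0.
have {}main := ler_wpM2l k32 main.
(* The slope exceeds [32 * k * (D r^2 + r)] by [32 * k * (D - 1) r^2]; this is
   that excess times [h * drift], up to the factor 512. *)
have gain : 0 <= h * k * ((D * r ^+ 2 + r) * ((D - 1) * r ^+ 2)).
  have D0 : 0 <= D by lra.
  have D1' : 0 <= D - 1 by lra.
  have D2 : 0 <= D * r ^+ 2 + r by rewrite addr_ge0 ?(ltW r0)// mulr_ge0// sqr_ge0.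
  have D3 : 0 <= (D - 1) * r ^+ 2 by rewrite mulr_ge0// sqr_ge0.
  exact: mulr_ge0 (mulr_ge0 (ltW h0) k0) (mulr_ge0 D2 D3).
lra.
Qed.

End penalty.

(** * Propagation of the comparison over one time step *)

Section comparison.
Variables (G : lfgraph) (R : realType).
Hypothesis curvG : nonneg_ollivier_ricci G R.
Implicit Types (x y z : vertex G) (w u : vertex G -> R).

Lemma ex_adj y : exists z, adj y z.
Proof.
have : (0 < size (nbrs y))%N := deg_gt0 y.
by case E : (nbrs y) => [//|z r] _; exists z; rewrite -mem_nbrs E mem_head.
Qed.

Lemma euler_jensen (h : R) u y : 0 < h ->
  euler h u y <= ln (euler h (fun v => expR (u v)) y).
Proof.
move=> h0; have [z yz] := ex_adj y.
have := gibbs_euler u h0 (lexx 0) _ yz; rewrite mulr0 => /(_ ler01).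
by rewrite mul0r expr0n mul0r subrr mulr0 addr0.
Qed.

Lemma ler_distance_jump (D D' : nat) : (D <= D' + 2)%N -> (D' <= D + 2)%N ->
  ((D'%:R - D%:R) ^+ 2 <= 4 :> R).
Proof.
rewrite -!(ler_nat R) !natrD => a b.
have := @mulr_ge0 R (2 - (D'%:R - D%:R)) (2 + (D'%:R - D%:R)); lra.
Qed.

(** The distance [D'] after a lazy step from both points differs from [D] by at
    most 2, so [D'^2 <= D^2 + 2 D (D' - D) + 4].  This makes the penalty at [D']
    at most an affine function of [D'] with slope [B >= 0], to which transport
    applies; the constant 4 is the only loss. *)
Lemma lazy_avg_penalty (k s : R) w u x y : 0 <= k -> 0 < s ->
    (forall z, 0 <= u z) ->
    (forall x' y', w x' <= u y' + penalty k s (gdist x' y')%:R) ->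
  lazy_avg w x <= lazy_avg u y + penalty k s (gdist x y)%:R + 128 * (k / s).
Proof.
move=> k0 s0 u0 wu; set D := gdist x y.
pose B : R := 32 * k * (2 * D%:R / s + (Num.sqrt s)^-1).
pose A : R := 32 * k * ((4 - D%:R ^+ 2) / s).
have k32 : 0 <= 32 * k by rewrite mulr_ge0.
have B0 : 0 <= B.
  by rewrite mulr_ge0// addr_ge0// ?divr_ge0 ?invr_ge0 ?mulr_ge0// ltW.
have := @lazy_avg_transport G R A B w u x y curvG B0 u0.
rewrite -/D (_ : _ + A + _ = lazy_avg u y + penalty k s D%:R + 128 * (k / s)).
  apply => x' y' xx' yy'; apply: le_trans (wu x' y') _.
  rewrite -addrA lerD2l; set D' := gdist x' y'.
  have DD' : (D <= D' + 2)%N by exact: gdist_ball.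
  have D'D : (D' <= D + 2)%N by apply: gdist_ball; rewrite gdistC.
  have J := ler_distance_jump DD' D'D.
  rewrite [leRHS](_ : _ = 32 * k * ((4 - D%:R ^+ 2) / s +
    (2 * D%:R / s + (Num.sqrt s)^-1) * D'%:R)); last by rewrite /A /B; ring.
  rewrite ler_wpM2l//.
  have := ler_wpM2r (ltW (_ : 0 < s^-1)) J; rewrite invr_gt0 => /(_ s0).
  lra.
rewrite /A /B /penalty; ring.
Qed.

(** The condition on [h] keeps the weight [1 - h - h * drift] of the pair
    [(x, y)] nonnegative.  No step [h] could satisfy it at all distances.  It is
    asked only where the penalty at the new time is below the bound [K] on [w],
    since elsewhere the conclusion is trivial. *)
Lemma euler_penalty_step (k K h s : R) w u :
    0 < h -> h <= 1 -> 0 < s -> (forall y, h + (deg y)%:R <= k) ->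
    (forall D : nat, penalty k (s + h) D%:R < K -> h * (1 + drift s D%:R) <= 1) ->
    (forall y, 0 <= u y) -> (forall y, w y <= K) ->
    (forall x y, w x <= u y + penalty k s (gdist x y)%:R) ->
  forall x y, euler h w x <=
    ln (euler h (fun v => expR (u v)) y) + penalty k (s + h) (gdist x y)%:R.
Proof.
move=> h0 h1 s0 degk small u0 wK wu x y.
have k0 : 0 <= k.
  by apply: le_trans (degk x); rewrite addr_ge0// ltW.
case E : (gdist x y) => [|n].
  rewrite (gdist_eq0 E) penalty0 addr0; apply: le_trans (euler_jensen u y h0).
  apply: euler_le (ltW h0) _ _ => v.
  by have := wu v v; rewrite gdistxx penalty0 addr0.
have [KD|DK] := leP K (penalty k (s + h) n.+1%:R).
  apply: le_trans (euler_ub (ltW h0) wK x) _; apply: le_trans KD _.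
  rewrite lerDr ln_ge0//; apply: euler_lb (ltW h0) _ _ => v.
  by rewrite -expR0 ler_expR.
have hd := small _ DK.
have [z yz xz] := geodesic_step E.
have dl0 : 0 <= drift s n.+1%:R by apply: drift_ge0 => //; exact: ltW.
set dl := drift s n.+1%:R in hd dl0.
have hdl : h * dl <= 1 by rewrite (le_trans _ hd)// mulrDr mulr1 lerDr ltW.
have L := gibbs_euler u h0 dl0 hdl yz.
set l := ln _ in L *.
have T := lazy_avg_penalty x y k0 s0 u0 wu; rewrite E in T.
have W1 := wu x y; rewrite E in W1.
have W2 := wu x z; rewrite xz in W2.
have D1 : 1 <= n.+1%:R :> R by rewrite ler1n.
have P := penalty_step k0 s0 h0 h1 D1.
rewrite -[n.+1%:R - 1](_ : n%:R = _) in P; last by rewrite -natr1 addrK.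
rewrite -/dl in P.
have dk : h * (dl ^+ 2 * (h + (deg y)%:R)) <= h * (dl ^+ 2 * k).
  by rewrite ler_wpM2l ?(ltW h0)// ler_wpM2l ?sqr_ge0.
have hp : 0 < 1 + h by lra.
have {}L := ler_wpM2l (ltW hp) L.
rewrite -(ler_pM2l hp) mulrDr eulerE ?(ltW h0)//.
rewrite mulrDr eulerE ?(ltW h0)// in L.
rewrite (mulrA (1 + h)) [(1 + h) * (h / _)]mulrC divfK ?gt_eqF// in L.
move: T; rewrite /lazy_avg.
move: (avg w x) (avg u y) => a b in L * => T.
have T' := ler_wpM2l (ltW h0) T.
have c1 : 0 <= 1 - h - h * dl by rewrite mulrDr mulr1 in hd; lra.
(* The weight of the pair [(x, y)] is what remains after jumps and drift; the
   weight [h * dl] goes to the pair [(x, z)]. *)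
have {c1}W1 := ler_wpM2l c1 W1.
have {}W2 := ler_wpM2l (_ : 0 <= h * dl) W2.
have {}W2 := W2 (mulr_ge0 (ltW h0) dl0).
lra.
Qed.

End comparison.

(** * The heat semigroup as a power series *)

Section semigroup.
Variables (G : lfgraph) (R : realType).
Implicit Types (x y z : vertex G) (f g : vertex G -> R).

Lemma iter_avg_ge c f k : (forall x, c <= f x) ->
  forall x, c <= iter k (@avg G R) f x.
Proof.
move=> cf; elim: k => //= k IHk x; rewrite -[leLHS](avg_cst c x).
by apply: avg_le => y _; exact: IHk.
Qed.

Lemma iter_avg_le c f k : (forall x, f x <= c) ->
  forall x, iter k (@avg G R) f x <= c.
Proof.
move=> cf; elim: k => //= k IHk x; rewrite -[leRHS](avg_cst c x).
by apply: avg_le => y _; exact: IHk.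
Qed.

Lemma iter_avgD f g k x :
  iter k (@avg G R) (fun z => f z + g z) x =
  iter k (@avg G R) f x + iter k (@avg G R) g x.
Proof. by elim: k x => //= k IHk x; rewrite -avgD; congr avg; exact/funext. Qed.

Lemma iter_avg_cst c k x : iter k (@avg G R) (fun=> c) x = c.
Proof.
by elim: k x => //= k IHk x; rewrite -[RHS](avg_cst c x); congr avg; exact/funext.
Qed.

Lemma rw_powS k x y : rw_pow R k.+1 x y = avg (fun z => rw_pow R k z y) x.
Proof.
by apply: EFin_inj; rewrite rw_powSE avg_esum_adj// => z; exact: rw_pow_ge0.
Qed.

Lemma iter_avg_esum f k x : (forall z, 0 <= f z) ->
  ((iter k (@avg G R) f x)%:E =
   \esum_(z in [set: vertex G]) (rw_pow R k x z * f z)%:E)%E.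
Proof.
move=> f0; elim: k x => [|k IHk] x; first by rewrite /= esum_delta.
rewrite iterS avg_esum; last by move=> z; exact: iter_avg_ge.
transitivity (\esum_(z in [set: vertex G]) \esum_(y in [set: vertex G])
    (rw R x z * (rw_pow R k z y * f y))%:E)%E.
  apply: eq_esum => z _; rewrite EFinM IHk -esumZl ?rw_ge0// => y.
  by rewrite lee_fin mulr_ge0// rw_pow_ge0.
rewrite exchange_esum; last first.
  by move=> z y; rewrite lee_fin !mulr_ge0 ?rw_ge0 ?rw_pow_ge0.
apply: eq_esum => y _; rewrite EFinM rw_powS avg_esum; last first.
  by move=> z; exact: rw_pow_ge0.
rewrite muleC -esumZl//; last first.
  by move=> z; rewrite lee_fin mulr_ge0 ?rw_ge0 ?rw_pow_ge0.
by apply: eq_esum => z _; rewrite -EFinM; congr EFin; ring.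
Qed.

Lemma rw_powE k x y :
  rw_pow R k x y = iter k (@avg G R) (fun z => (z == y)%:R) x.
Proof.
elim: k x => [//|k IHk] x; rewrite rw_powS iterS; congr avg.
by apply/funext => z; exact: IHk.
Qed.

Definition semigroup (t : R) f x : R :=
  expR (- t) * limn (series (fun k => t ^+ k / k`!%:R * iter k (@avg G R) f x)).

Lemma heatE t x y : heat t x y = semigroup t (fun z => (z == y)%:R) x.
Proof.
rewrite /heat /semigroup; congr (_ * _).
by under eq_fun do rewrite rw_powE.
Qed.

Section positive_time.
Variables (t : R) (t0 : 0 < t).

Lemma exp_coef_ge0 k : 0 <= t ^+ k / k`!%:R :> R.
Proof. by rewrite divr_ge0// exprn_ge0// ltW. Qed.

Lemma is_cvg_semigroup M f x : (forall z, 0 <= f z <= M) ->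
  cvgn (series (fun k => t ^+ k / k`!%:R * iter k (@avg G R) f x)).
Proof.
move=> fM.
have cM := @is_cvg_seriesZ R^o (exp_coeff t) M (is_cvg_series_exp_coeff t).
apply: series_le_cvg cM => k.
- by rewrite mulr_ge0 ?exp_coef_ge0//; apply: iter_avg_ge => z; case/andP: (fM z).
- by rewrite mulr_ge0 ?exp_coef_ge0//; case/andP: (fM x) => /le_trans; apply.
- rewrite [leRHS]mulrC ler_wpM2l ?exp_coef_ge0//.
  by apply: iter_avg_le => z; case/andP: (fM z).
Qed.

Lemma semigroupD M f g x : (forall z, 0 <= f z <= M) -> (forall z, 0 <= g z <= M) ->
  semigroup t (fun z => f z + g z) x = semigroup t f x + semigroup t g x.
Proof.
move=> fM gM; rewrite /semigroup -mulrDr -limD; last 2 first.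
- exact: (is_cvg_semigroup fM).
- exact: (is_cvg_semigroup gM).
rewrite -seriesD; congr (_ * _).
by under eq_fun do rewrite iter_avgD mulrDr.
Qed.

Lemma semigroup_cst c x : semigroup t (fun=> c) x = c.
Proof.
rewrite /semigroup.
have -> : series (fun k => t ^+ k / k`!%:R * iter k (@avg G R) (fun=> c) x) =
    c *: series (exp_coeff t).
  rewrite -seriesZ; congr series; apply/funext => k.
  by rewrite iter_avg_cst mulrC.
have /cvg_lim -> // : c *: series (exp_coeff t) @ \oo --> (c * expR t : R^o).
  exact: cvgZl_tmp (is_cvg_series_exp_coeff t).
by rewrite mulrCA -expRD addNr expR0 mulr1.
Qed.

Lemma semigroup_esum M f x : (forall z, 0 <= f z <= M) ->
  ((semigroup t f x)%:E = (expR (- t))%:E *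
  \esum_(k in [set: nat]) (t ^+ k / k`!%:R * iter k (@avg G R) f x)%:E)%E.
Proof.
move=> fM; rewrite /semigroup EFinM -(EFin_lim (is_cvg_semigroup (x := x) fM)).
congr (_ * _)%E; rewrite -nneseries_esumT; last first.
  move=> k; rewrite lee_fin mulr_ge0 ?exp_coef_ge0//.
  by apply: iter_avg_ge => z; case/andP: (fM z).
by apply: congr_lim; apply/funext => n; rewrite /= sumEFin.
Qed.

Lemma semigroup_heat M f x : (forall z, 0 <= f z <= M) ->
  ((semigroup t f x)%:E = \esum_(z in [set: vertex G]) (heat t x z * f z)%:E)%E.
Proof.
move=> fM; rewrite (semigroup_esum x fM).
have f0 z : 0 <= f z by case/andP: (fM z).
have term0 k z : (0 <= (t ^+ k / k`!%:R * rw_pow R k x z)%:E)%E.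
  by rewrite lee_fin mulr_ge0 ?exp_coef_ge0 ?rw_pow_ge0.
transitivity ((expR (- t))%:E * \esum_(z in [set: vertex G])
    \esum_(k in [set: nat]) ((f z)%:E * (t ^+ k / k`!%:R * rw_pow R k x z)%:E))%E.
  rewrite [in RHS]exchange_esum; last by move=> z k; rewrite mule_ge0// lee_fin.
  congr (_ * _)%E; apply: eq_esum => k _; rewrite EFinM iter_avg_esum//.
  rewrite -esumZl ?exp_coef_ge0//; last first.
    by move=> z; rewrite lee_fin mulr_ge0 ?rw_pow_ge0.
  by apply: eq_esum => z _; rewrite -!EFinM; congr EFin; ring.
rewrite -esumZl ?expR_ge0//; last first.
  by move=> z; apply: esum_ge0 => k _; rewrite mule_ge0// lee_fin.
apply: eq_esum => z _; rewrite esumZl// EFinM heatE.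
rewrite (@semigroup_esum 1); last by move=> v; rewrite ler0n lern1 leq_b1.
rewrite muleCA [RHS]muleC; congr (_ * (_ * _))%E.
by apply: eq_esum => k _; rewrite rw_powE.
Qed.

End positive_time.
End semigroup.

(** * Convergence of the Euler scheme *)

Section euler_limit.
Variables (G : lfgraph) (R : realType).
Implicit Types (x y z : vertex G) (f g : vertex G -> R).

(** This is the binomial expansion of [(I + h P)^n]. *)
Lemma iter_eulerE (h : R) f n x : 0 <= h ->
  (1 + h) ^+ n * iter n (euler h) f x =
  \sum_(k < n.+1) ('C(n, k)%:R * h ^+ k) * iter k (@avg G R) f x.
Proof.
move=> h0; elim: n x => [|n IHn] x.
  by rewrite big_ord_recl big_ord0 bin0 !expr0 !mul1r addr0.
rewrite iterS exprSr -mulrA eulerE// mulrDr IHn (mulrCA _ h) -avgZ.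
have -> : (fun y => (1 + h) ^+ n * iter n (euler h) f y) = (fun y =>
    \sum_(k < n.+1) ('C(n, k)%:R * h ^+ k) * iter k (@avg G R) f y).
  exact/funext.
rewrite (avg_sum n.+1 (fun k => 'C(n, k)%:R * h ^+ k)
  (fun k => iter k (@avg G R) f)).
rewrite [RHS]big_ord_recl bin0 /=.
under [in RHS]eq_bigr => k _ do rewrite binS natrD mulrDl mulrDl.
rewrite big_split /= addrA; congr (_ + _).
  rewrite [LHS]big_ord_recl bin0 /=; congr (_ + _).
  by rewrite [RHS]big_ord_recr /= bin_small// !mul0r addr0.
rewrite mulr_sumr; apply: eq_bigr => k _.
by rewrite exprS; ring.
Qed.

Lemma ffact_le_exp n k : (n ^_ k <= n ^ k)%N.
Proof.
elim: k => // k IHk; by rewrite ffactnSr expnSr leq_mul// leq_subr.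
Qed.

Lemma bin_expr_le (t : R) n k : 0 <= t -> (0 < n)%N ->
  'C(n, k)%:R * (t / n%:R) ^+ k <= t ^+ k / k`!%:R.
Proof.
move=> t0 n0; have n0' : 0 < n%:R :> R by rewrite ltr0n.
have k0 : 0 < k`!%:R :> R by rewrite ltr0n fact_gt0.
rewrite ler_pdivlMr// mulrAC -natrM bin_ffact expr_div_n mulrCA.
rewrite ler_piMr ?exprn_ge0// ler_pdivrMr ?exprn_gt0// mul1r -natrX ler_nat.
exact: ffact_le_exp.
Qed.

Lemma bernoulli_sub (a : R) n : 0 <= a <= 1 -> 1 - n%:R * a <= (1 - a) ^+ n.
Proof.
move=> /andP[a0 a1]; elim: n => [|n IHn]; first by rewrite mul0r subr0 expr0.
rewrite exprS -natr1; have := ler_wpM2l (_ : 0 <= 1 - a) IHn.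
rewrite subr_ge0 => /(_ a1); apply: le_trans.
have : 0 <= n%:R * (a * a) by rewrite !mulr_ge0.
lra.
Qed.

Lemma exp_le_euler (t : R) n : 0 < t -> t <= n%:R ->
  (1 - t ^+ 2 / n%:R) * expR t <= (1 + t / n%:R) ^+ n.
Proof.
move=> t0 tn; have n0 : 0 < n%:R :> R by lra.
set h := t / n%:R; have h0 : 0 < h by rewrite divr_gt0.
have h1 : h <= 1 by rewrite ler_pdivrMr// mul1r.
have th : t = n%:R * h by rewrite mulrCA mulfV ?mulr1// gt_eqF.
have h2 : 0 <= h ^+ 2 <= 1 by rewrite sqr_ge0 expr_le1// ltW.
have -> : t ^+ 2 / n%:R = n%:R * h ^+ 2.
  by rewrite /h expr_div_n; field; rewrite gt_eqF.
rewrite -ler_pdivlMr ?expR_gt0// -expRN.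
have -> : expR (- t) = expR (- h) ^+ n by rewrite -expRM_natl mulrN -th.
rewrite -exprMn.
apply: le_trans (bernoulli_sub n h2) _.
case/andP: h2 => _ h2.
rewrite lerXn2r ?nnegrE ?subr_ge0// ?mulr_ge0 ?expR_ge0//; first by lra.
have := expR_ge1Dx (- h) => /(ler_wpM2l (_ : 0 <= 1 + h)).
have hp : 0 <= 1 + h by lra.
by move=> /(_ hp); lra.
Qed.

Variables (t : R) (t0 : 0 < t).

(** The [k]-th binomial weight [C(n, k) (t / n)^k] is at most [t^k / k!], and
    the two normalisations [(1 + t / n)^n] and [exp t] have ratio at least
    [1 - t^2 / n].  Comparing term by term bounds the scheme on one side only;
    complementing [f] to its upper bound gives the other side, in
    [semigroup_le_euler]. *)
Lemma euler_le_semigroup M f n x : (forall z, 0 <= f z <= M) -> t <= n%:R ->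
  (1 - t ^+ 2 / n%:R) * iter n (euler (t / n%:R)) f x <= semigroup t f x.
Proof.
move=> fM tn; have n0 : 0 < n%:R :> R := lt_le_trans t0 tn.
have f0 z : 0 <= f z by case/andP: (fM z).
have h0 : 0 <= t / n%:R by rewrite divr_ge0// ltW.
rewrite -(ler_pM2l (expR_gt0 t)) /semigroup [leRHS]mulrA -expRD subrr expR0 mul1r.
rewrite mulrA [expR t * _]mulrC.
apply: le_trans (_ : (1 + t / n%:R) ^+ n * iter n (euler (t / n%:R)) f x <= _).
  by rewrite ler_wpM2r ?exp_le_euler//; exact: iter_euler_lb.
rewrite iter_eulerE//.
apply: le_trans (_ : series (fun k => t ^+ k / k`!%:R * iter k (@avg G R) f x) n.+1 <= _).
  rewrite /series /= big_mkord; apply: ler_sum => k _.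
  rewrite ler_wpM2r ?bin_expr_le ?(ltW t0)// -?(ltr0n R)//.
  exact: iter_avg_ge.
apply: nondecreasing_cvgn_le; last exact: is_cvg_semigroup fM.
apply: nondecreasing_series => k _ _.
by rewrite mulr_ge0 ?exp_coef_ge0//; exact: iter_avg_ge.
Qed.

Lemma iter_eulerB (h M : R) f n x : 0 <= h ->
  iter n (euler h) (fun z => M - f z) x = M - iter n (euler h) f x.
Proof.
move=> h0; elim: n x => // n IHn x.
rewrite !iterS -[in RHS](euler_cst M x h0) -eulerB; congr euler; exact/funext.
Qed.

Lemma semigroup_le_euler M f n x : (forall z, 0 <= f z <= M) -> t <= n%:R ->
  semigroup t f x <= iter n (euler (t / n%:R)) f x + t ^+ 2 / n%:R * M.
Proof.
move=> fM tn; have n0 : 0 < n%:R :> R := lt_le_trans t0 tn.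
have h0 : 0 <= t / n%:R by rewrite divr_ge0// ltW.
have f0 z : 0 <= f z by case/andP: (fM z).
have gM z : 0 <= M - f z <= M by have /andP[a b] := fM z; apply/andP; lra.
have := euler_le_semigroup x gM tn; rewrite iter_eulerB//.
have := semigroupD t0 x fM gM.
rewrite (_ : (fun z => f z + (M - f z)) = fun=> M); last first.
  by apply/funext => z; rewrite addrC subrK.
rewrite semigroup_cst => SM.
have e0 : 0 <= t ^+ 2 / n%:R by rewrite divr_ge0 ?sqr_ge0// ltW.
have := mulr_ge0 e0 (iter_euler_lb n h0 f0 x).
lra.
Qed.

End euler_limit.

(** * The log-Harnack inequality for functions bounded away from 0 *)

Section log_harnack.
Variables (G : lfgraph) (R : realType) (d : R).
Hypothesis curvG : nonneg_ollivier_ricci G R.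
Hypothesis degG : forall z : vertex G, (deg z)%:R <= d.
Implicit Types (x y z : vertex G) (f g : vertex G -> R).

Lemma ler_nat_sqr (D : nat) : D%:R <= D%:R ^+ 2 :> R.
Proof. by rewrite -natrX ler_nat; nia. Qed.

(** A penalty smaller than [K] forces [D <= D^2 <= K * T], so the drift is
    bounded by its value at distance [K * T] and at the earliest time [s0]. *)
Lemma penalty_small (k K s0 T h s : R) (D : nat) :
    1 <= k -> 0 < s0 -> s0 <= s -> 0 < h -> s + h <= T ->
    h * (1 + drift s0 (K * T)) <= 1 ->
  penalty k (s + h) D%:R < K -> h * (1 + drift s D%:R) <= 1.
Proof.
move=> k1 s00 s0s h0 sT hK DK; apply: le_trans hK.
have s_gt0 : 0 < s by lra.
have sh0 : 0 < s + h by lra.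
have DKT : D%:R <= K * T.
  have D2 : D%:R ^+ 2 / (s + h) <= K.
    apply: ltW; apply: le_lt_trans DK; rewrite /penalty.
    have a0 : 0 <= D%:R ^+ 2 / (s + h) by rewrite divr_ge0 ?sqr_ge0// ltW.
    have b0 : 0 <= D%:R / Num.sqrt (s + h) by rewrite divr_ge0.
    apply: (@le_trans _ _ (1 * (D%:R ^+ 2 / (s + h) + D%:R / Num.sqrt (s + h)))).
      by rewrite mul1r lerDl.
    by rewrite ler_wpM2r ?addr_ge0//; lra.
  have K0 : 0 <= K.
    by apply: le_trans D2; rewrite divr_ge0 ?sqr_ge0// ltW.
  rewrite ler_pdivrMr// in D2.
  apply: le_trans (ler_nat_sqr D) _; apply: le_trans D2 _.
  by rewrite ler_wpM2l.
rewrite ler_wpM2l ?(ltW h0)// lerD2l ler_wpM2l// lerD//.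
  apply: ler_pM => //; first by rewrite invr_ge0 ltW.
  by rewrite lef_pV2 ?posrE.
rewrite lef_pV2 ?posrE ?sqrtr_gt0//.
by rewrite ler_wsqrtr.
Qed.

(** The clock starts at [s0 > 0] instead of 0: as [K <= 1 / s0], the penalty at
    time [s0] is at least [K] off the diagonal, which starts the
    induction. *)
Lemma discrete_log_harnack (k K s0 h : R) g n :
    0 < h -> h <= 1 -> (forall y, h + (deg y)%:R <= k) ->
    0 < s0 -> s0 * K <= 1 ->
    h * (1 + drift s0 (K * (s0 + h *+ n))) <= 1 ->
    (forall z, 0 <= g z <= K) ->
  forall x y, iter n (euler h) g x <=
    ln (iter n (euler h) (fun v => expR (g v)) y)
    + penalty k (s0 + h *+ n) (gdist x y)%:R.
Proof.
move=> h0 h1 degk s00 s0K small gK.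
have g0 z : 0 <= g z by case/andP: (gK z).
have gle z : g z <= K by case/andP: (gK z).
pose e i := iter i (euler h) (fun v => expR (g v)).
have e1 i v : 1 <= e i v.
  by apply: iter_euler_lb (ltW h0) _ _ => z; rewrite -expR0 ler_expR.
suff H i : (i <= n)%N -> forall x y, iter i (euler h) g x <=
    ln (e i y) + penalty k (s0 + h *+ i) (gdist x y)%:R by exact: H.
elim: i => [_ x y|i IHi lin x y].
  rewrite /e /= expRK mulr0n addr0; case E : (gdist x y) => [|m].
    by rewrite (gdist_eq0 E) penalty0 addr0.
  apply: (@le_trans _ _ K) => //.
  apply: (@le_trans _ _ (penalty k s0 m.+1%:R)); last first.
    by rewrite lerDr.
  have k1 : 1 <= k.
    apply: le_trans (degk x); have := deg_ge1 R x; lra.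
  have D1 : 1 <= m.+1%:R ^+ 2 :> R by rewrite -natrX ler1n expn_gt0.
  have Ks : K <= s0^-1 by rewrite -[leRHS]mul1r ler_pdivlMr// mulrC.
  apply: le_trans Ks _; rewrite /penalty.
  have a0 : 0 <= m.+1%:R / Num.sqrt s0 by rewrite divr_ge0.
  have b0 : 0 <= s0^-1 by rewrite invr_ge0 ltW.
  have b1 : s0^-1 <= m.+1%:R ^+ 2 / s0 by rewrite ler_peMl.
  have c0 := le_trans b0 b1; apply: le_trans b1 _.
  apply: (@le_trans _ _ (1 * (m.+1%:R ^+ 2 / s0 + m.+1%:R / Num.sqrt s0))).
    by rewrite mul1r lerDl.
  by rewrite ler_wpM2r ?addr_ge0//; lra.
have si : s0 <= s0 + h *+ i by rewrite lerDl mulrn_wge0// ltW.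
have -> : e i.+1 = euler h (fun v => expR (ln (e i v))).
  rewrite /e iterS; congr euler; apply/funext => v.
  by rewrite lnK// posrE (lt_le_trans ltr01 (e1 i v)).
rewrite iterS mulrSr addrA.
apply: (euler_penalty_step curvG (K := K)) => //.
- by lra.
- move=> D; apply: (penalty_small _ s00 si h0 _ small).
    by apply: le_trans (degk x); have := deg_ge1 R x; lra.
  by rewrite -addrA -mulrSr lerD2l ler_wpMn2l// ltW.
- by move=> v; rewrite ln_ge0.
- exact: iter_euler_ub (ltW h0) gle.
- by move=> x' y'; apply: IHi; exact: ltnW.
Qed.

Lemma ln_div_sub (a e : R) : 0 < a -> 0 <= e -> e <= 2^-1 ->
  ln (a / (1 - e)) <= ln a + 2 * e.
Proof.
move=> a0 e0 e2; have e1 : 0 < 1 - e by lra.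
rewrite lnM ?posrE ?invr_gt0// lerD2l.
have : ln (1 + ((1 - e)^-1 - 1)) <= (1 - e)^-1 - 1.
  by apply: le_ln1Dx; rewrite ltrBrDr addrC subrr invr_gt0.
rewrite addrC subrK => /le_trans; apply.
rewrite lerBlDr -[leLHS]mul1r ler_pdivrMr//; nra.
Qed.

Lemma penaltyD (k1 k2 s D : R) :
  penalty (k1 + k2) s D = penalty k1 s D + penalty k2 s D.
Proof. by rewrite /penalty; ring. Qed.

Lemma penalty_scale (k s D : R) : penalty k s D = k * penalty 1 s D.
Proof. by rewrite /penalty; ring. Qed.

Lemma penalty_antitone (k s s' D : R) : 0 <= k -> 0 <= D -> 0 < s -> s <= s' ->
  penalty k s' D <= penalty k s D.
Proof.
move=> k0 D0 s0 ss'; have s'0 : 0 < s' by lra.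
rewrite ler_wpM2l ?mulr_ge0// lerD// ler_wpM2l ?sqr_ge0//.
  by rewrite lef_pV2 ?posrE.
by rewrite lef_pV2 ?posrE ?sqrtr_gt0// ler_wsqrtr.
Qed.

(** The [n] steps of length [h = t / n] are run from time [s0] to [s0 + t], with
    [d + h] in the penalty; as the penalty decreases in time, [s0] disappears
    from the bound.  All the remaining errors are at most [C / n]. *)
Lemma log_harnack_semigroup (t K : R) g x y : 0 < t ->
    (forall z, 0 <= g z <= K) ->
  semigroup t g x <= ln (semigroup t (fun z => expR (g z)) y)
    + penalty d t (gdist x y)%:R.
Proof.
move=> t0 gK; apply/ler_addgt0Pr => eps eps0.
have K0 : 0 <= K by have /andP[] := gK x; exact: le_trans.
pose s0 := (K + 1)^-1; have s00 : 0 < s0 by rewrite invr_gt0; lra.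
set D : R := (gdist x y)%:R.
have P0 : 0 <= penalty 1 t D by apply: penalty_ge0 => //; exact: ltW.
pose L := t * (1 + drift s0 (K * (s0 + t))).
pose C := (2 + K) * t ^+ 2 + t * penalty 1 t D.
have dr0 : 0 <= drift s0 (K * (s0 + t)).
  by apply: drift_ge0; [exact: ltW|rewrite mulr_ge0// addr_ge0// ltW].
have L0 : 0 <= L by rewrite mulr_ge0; lra.
have t2 : 0 < t ^+ 2 by rewrite exprn_gt0.
have C0 : 0 <= C.
  by apply: addr_ge0; apply: mulr_ge0; rewrite ?(ltW t2) ?(ltW t0)//; lra.
pose B := t + 2 * t ^+ 2 + L + C / eps.
have [n Bn] : exists n, B <= n%:R.
  by exists (Num.truncn B).+1; rewrite ltW// truncnS_gt.
have Ce : 0 <= C / eps by rewrite divr_ge0// ltW.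
have tn : t <= n%:R by rewrite /B in Bn; lra.
have n0 : 0 < n%:R :> R by lra.
set h := t / n%:R; set e := t ^+ 2 / n%:R.
have h0 : 0 < h by rewrite divr_gt0.
have h1 : h <= 1 by rewrite ler_pdivrMr// mul1r.
have hn : h *+ n = t by rewrite -mulr_natr divfK// gt_eqF.
have e0 : 0 <= e by rewrite divr_ge0// ltW.
have e2 : e <= 2^-1 by rewrite ler_pdivrMr//; rewrite /B in Bn; lra.
have degk z : h + (deg z)%:R <= d + h by have := degG z; lra.
have s0K : s0 * K <= 1 by rewrite mulrC ler_pdivrMr; lra.
have small : h * (1 + drift s0 (K * (s0 + h *+ n))) <= 1.
  by rewrite hn mulrAC ler_pdivrMr// mul1r -/L; rewrite /B in Bn; lra.
have H := discrete_log_harnack h0 h1 degk s00 s0K small gK x y.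
rewrite hn -/D in H.
have A1 := semigroup_le_euler t0 x gK tn; rewrite -/h -/e in A1.
have eK z : 0 <= expR (g z) <= expR K.
  by rewrite expR_ge0 ler_expR; case/andP: (gK z).
have A2 := euler_le_semigroup t0 y eK tn; rewrite -/h -/e in A2.
set I := iter n (euler h) (fun v => expR (g v)) y in H A2.
have I1 : 1 <= I.
  apply: iter_euler_lb (ltW h0) _ _ => z; rewrite -expR0 ler_expR.
  by case/andP: (gK z).
set S := semigroup t _ y in A2 *.
have e1 : 0 < 1 - e by lra.
have S0 : 0 < S by apply: lt_le_trans A2; rewrite mulr_gt0//; lra.
have IS : ln I <= ln S + 2 * e.
  apply: le_trans (ln_div_sub S0 e0 e2); rewrite ler_ln ?posrE ?divr_gt0//; last by lra.
  by rewrite ler_pdivlMr// mulrC.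
have d0 : 0 <= d by apply: le_trans (degG x).
have PD : penalty (d + h) (s0 + t) D <= penalty d t D + h * penalty 1 t D.
  rewrite -penalty_scale -penaltyD; apply: penalty_antitone => //; lra.
have CE : 2 * e + e * K + h * penalty 1 t D <= eps.
  have -> : 2 * e + e * K + h * penalty 1 t D = C / n%:R.
    by rewrite /C /e /h; field; rewrite gt_eqF.
  rewrite ler_pdivrMr// mulrC -ler_pdivrMr//.
  by rewrite /B in Bn; lra.
lra.
Qed.

End log_harnack.

(** * The log-Harnack inequality for positive bounded functions *)

Section signed_sums.
Variables (G : lfgraph) (R : realType).
Implicit Types (x y z : vertex G) (f g : vertex G -> R) (a b : vertex G -> \bar R).

Lemma sumpn_ge0 a : (forall z, (0 <= a z)%E) ->
  sumpn a = (\esum_(z in [set: vertex G]) a z)%E.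
Proof.
move=> a0; rewrite /sumpn [X in (_ - X)%E]esum1 ?sube0; last first.
  by move=> z _; rewrite funenegE max_r// leeNl oppe0.
by apply: eq_esum => z _; rewrite funeposE max_l.
Qed.

Lemma sumpn_le a b : (forall z, (a z <= b z)%E) -> (sumpn a <= sumpn b)%E.
Proof.
move=> ab; apply: leeB; apply: le_esum => z _.
  by rewrite !funeposE ge_max le_max ab/= le_max lexx orbT.
by rewrite !funenegE ge_max le_max leeN2 ab/= le_max lexx orbT.
Qed.

Variables (t : R) (t0 : 0 < t).

Lemma semigroup_le M f M' g x : (forall z, 0 <= f z <= M) ->
  (forall z, 0 <= g z <= M') -> (forall z, f z <= g z) ->
  semigroup t f x <= semigroup t g x.
Proof.
move=> fM gM fg; rewrite -lee_fin (semigroup_heat t0 x fM) (semigroup_heat t0 x gM).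
by apply: le_esum => z _; rewrite lee_fin ler_wpM2l// heat_ge0.
Qed.

Lemma heat_op_ge0 M f x : (forall z, 0 <= f z <= M) ->
  heat_op t f x = (semigroup t f x)%:E.
Proof.
move=> fM; rewrite (semigroup_heat t0 x fM); apply: sumpn_ge0 => z.
by rewrite lee_fin mulr_ge0 ?heat_ge0//; case/andP: (fM z).
Qed.

(** Once [f] is bounded away from 0, [log f] is a bounded nonnegative function
    minus a constant, and this turns its signed sum into a finite number. *)
Lemma heat_op_shift M L g x : 0 <= L -> (forall z, 0 <= g z <= M) ->
  heat_op t (fun z => g z - L) x = (semigroup t g x - L)%:E.
Proof.
move=> L0 gM; have hz z : 0 <= heat t x z := heat_ge0 t0 x z.
have g0 z : (0 <= (heat t x z * g z)%:E)%E.
  by rewrite lee_fin mulr_ge0//; case/andP: (gM z).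
have l0 z : (0 <= (heat t x z * L)%:E)%E by rewrite lee_fin mulr_ge0.
have LL z : 0 <= L <= L by rewrite L0 lexx.
have gE := semigroup_heat t0 x gM.
have lE := semigroup_heat t0 x LL; rewrite semigroup_cst in lE.
have -> : heat_op t (fun z => g z - L) x =
    sumpn ((fun z => (heat t x z * g z)%:E) \- (fun z => (heat t x z * L)%:E))%E.
  by congr sumpn; apply/funext => z /=; rewrite -EFinB mulrBr.
rewrite /sumpn esumB//.
- by rewrite -gE -lE -EFinB.
- rewrite /summable (eq_esum (b := fun z => (heat t x z * g z)%:E)) -?gE ?ltry//.
  by move=> z _; rewrite gee0_abs.
- rewrite /summable (eq_esum (b := fun z => (heat t x z * L)%:E)) -?lE ?ltry//.
  by move=> z _; rewrite gee0_abs.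
Qed.

Lemma rw_pow_gt0 x y k : walk x y k -> 0 < rw_pow R k x y.
Proof.
elim: k x => [|k IHk] x [[|z p] [//= xp py sp]]; first by rewrite py eqxx ltr01.
case/andP: xp => xz zp; rewrite -/(rw_pow R k.+1 x y) rw_powS.
have kz : 0 < rw_pow R k z y by apply: IHk; exists p; split=> //; case: sp.
apply: lt_le_trans (_ : 0 < avg (fun v => if v == z then rw_pow R k z y else 0) x) _.
  by rewrite avg_delta// divr_gt0// ltr0n deg_gt0.
by apply: avg_le => v _; case: eqP => [->//|_]; exact: rw_pow_ge0.
Qed.

Lemma heat_gt0 x y : 0 < heat t x y.
Proof.
rewrite heatE mulr_gt0 ?expR_gt0//; set k := gdist x y.
have b z : 0 <= ((z == y)%:R : R) <= 1 by rewrite ler0n lern1 leq_b1.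
have c := is_cvg_semigroup t0 (x := x) b.
have term0 j : 0 <= t ^+ j / j`!%:R * iter j (@avg G R) (fun z => (z == y)%:R) x.
  by rewrite mulr_ge0 ?exp_coef_ge0// -rw_powE rw_pow_ge0.
apply: lt_le_trans (nondecreasing_cvgn_le (nondecreasing_series _) c k.+1).
  rewrite /series /= big_mkord big_ord_recr /= ltr_wpDl//.
    by apply: sumr_ge0 => j _; exact: term0.
  rewrite -rw_powE mulr_gt0 ?rw_pow_gt0//; last exact: gdist_walk.
  by rewrite divr_gt0 ?exprn_gt0// ltr0n fact_gt0.
by move=> j _ _; exact: term0.
Qed.

Lemma semigroup_gt0 M f x : (forall z, 0 < f z <= M) -> 0 < semigroup t f x.
Proof.
move=> fM; have fM' z : 0 <= f z <= M by have /andP[/ltW -> ->] := fM z.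
rewrite -lte_fin (semigroup_heat t0 x fM').
apply: lt_le_trans (_ : (0 < (heat t x x * f x)%:E)%E) _.
  by rewrite lte_fin mulr_gt0 ?heat_gt0//; case/andP: (fM x).
by apply: esum_ge; exists [set x]; [split|rewrite fsbig_set1].
Qed.

Lemma semigroupZ M c f x : 0 <= c -> (forall z, 0 <= f z <= M) ->
  semigroup t (fun z => c * f z) x = c * semigroup t f x.
Proof.
move=> c0 fM; apply: EFin_inj.
have cM z : 0 <= c * f z <= c * M.
  by have /andP[f0 fM'] := fM z; rewrite mulr_ge0// ler_wpM2l.
rewrite (semigroup_heat t0 x cM) EFinM (semigroup_heat t0 x fM) -esumZl//.
  by apply: eq_esum => z _; rewrite -EFinM mulrCA.
by move=> z; rewrite lee_fin mulr_ge0 ?heat_ge0//; case/andP: (fM z).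
Qed.

End signed_sums.

Section log_harnack_heat_op.
Variables (G : lfgraph) (R : realType) (d : R).
Hypothesis curvG : nonneg_ollivier_ricci G R.
Hypothesis degG : forall z : vertex G, (deg z)%:R <= d.

Lemma expRN_le (e : R) : 0 < e -> expR (- e^-1) <= e.
Proof.
move=> e0; rewrite expRN -[leRHS]invrK lef_pV2 ?posrE ?invr_gt0 ?expR_gt0//.
by apply: le_trans (expR_ge1Dx _); rewrite lerDr.
Qed.

Lemma ln_add_le (a e : R) : 0 < a -> 0 <= e -> ln (a + e) <= ln a + e / a.
Proof.
move=> a0 e0; have -> : a + e = a * (1 + e / a) by field; rewrite gt_eqF.
have ea : 0 <= e / a by rewrite divr_ge0// ltW.
rewrite lnM ?posrE//; last lra.
by rewrite lerD2l le_ln1Dx//; lra.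
Qed.

(** Let [fL] be the maximum of [f] and [exp (- L)].  The inequality is applied
    to [ln fL + L >= 0], whose exponential is at most [exp L * f + 1].  The shift
    by [L] cancels, and the added 1 costs [exp (- L) / P_t f y], which tends
    to 0. *)
Lemma log_harnack_heat_op (t M : R) (f : vertex G -> R) x y : 0 < t ->
    (forall z, 0 < f z) -> (forall z, f z <= M) ->
  (heat_op t (fun z => ln (f z)) x <=
   lne (heat_op t f y) + (penalty d t (gdist x y)%:R)%:E)%E.
Proof.
move=> t0 f0 fM; have fM' z : 0 <= f z <= M by rewrite ltW ?fM.
have f0M z : 0 < f z <= M by rewrite f0 fM.
rewrite (heat_op_ge0 t0 y fM'); set F := semigroup t f y.
have F0 : 0 < F := semigroup_gt0 t0 y f0M.
rewrite lne_EFin//; apply/lee_addgt0Pr => e e0.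
have eF : 0 < e * F by rewrite mulr_gt0.
pose L := (e * F)^-1; have L0 : 0 < L by rewrite invr_gt0.
have M0 : 0 < M by exact: lt_le_trans (fM x).
pose fL z := Num.max (f z) (expR (- L)).
pose K := ln (Num.max M 1) + L.
have fL0 z : 0 < fL z by rewrite lt_max f0.
have gK z : 0 <= ln (fL z) + L <= K.
  apply/andP; split.
    rewrite -lerBlDr sub0r -{1}(expRK (- L)) ler_ln ?posrE ?expR_gt0//.
    by rewrite le_max lexx orbT.
  have M1 : 0 < Num.max M 1 by rewrite lt_max M0.
  rewrite lerD2r ler_ln ?posrE// /fL ge_max !le_max fM /=.
  by rewrite -[X in _ || (_ <= X)]expR0 ler_expR oppr_le0 (ltW L0) orbT.
have H := log_harnack_semigroup curvG degG x y t0 gK.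
have eE z : expR (ln (fL z) + L) = expR L * fL z by rewrite expRD lnK ?posrE// mulrC.
have eL0 : 0 < expR L := expR_gt0 L.
have fe z : expR (ln (fL z) + L) <= expR L * f z + 1.
  rewrite eE /fL; have [_|_] := leP (f z) (expR (- L)); last by rewrite lerDl.
  by rewrite -expRD subrr expR0 lerDr mulr_ge0// ltW.
have g1 z : 0 <= expR (ln (fL z) + L) <= expR K.
  by rewrite expR_ge0 ler_expR; case/andP: (gK z).
have f1 z : 0 <= expR L * f z <= expR L * M + 1.
  rewrite mulr_ge0 ?(ltW eL0) ?(ltW (f0 z))//=.
  by rewrite ler_wpDr// ler_wpM2l// ltW.
have c1 (z : vertex G) : 0 <= (1 : R) <= expR L * M + 1.
  by rewrite ler01 lerDr mulr_ge0// ltW.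
have f2 z : 0 <= expR L * f z + 1 <= expR L * M + 1 + 1.
  by have /andP[a b] := f1 z; rewrite lerD2r b andbT addr_ge0.
have S := semigroup_le t0 y g1 f2 fe.
rewrite (semigroupD t0 y f1 c1) semigroup_cst (semigroupZ t0 y (ltW eL0) fM') -/F in S.
have S0 : 0 < semigroup t (fun z => expR (ln (fL z) + L)) y.
  apply: (@semigroup_gt0 G R t t0 (expR K)) => z.
  by rewrite expR_gt0; case/andP: (g1 z).
have lnS : ln (semigroup t (fun z => expR (ln (fL z) + L)) y) <= L + (ln F + e).
  have FL : 0 < F + expR (- L) by rewrite addr_gt0// expR_gt0.
  apply: (@le_trans _ _ (ln (expR L * (F + expR (- L))))).
    rewrite ler_ln ?posrE//; last by rewrite mulr_gt0.
    by rewrite mulrDr -expRD subrr expR0.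
  rewrite lnM ?posrE// expRK lerD2l; apply: le_trans (ln_add_le F0 (expR_ge0 _)) _.
  by rewrite lerD2l ler_pdivrMr//; exact: expRN_le.
apply: (@le_trans _ _ (heat_op t (fun z => (ln (fL z) + L) - L) x)).
  apply: sumpn_le => z; rewrite addrK lee_fin ler_wpM2l ?heat_ge0//.
  by rewrite ler_ln ?posrE// le_max lexx.
rewrite (heat_op_shift t0 x (ltW L0) gK) -!EFinD lee_fin.
clear c1; lra.
Qed.

End log_harnack_heat_op.

(** * The entropy inequality *)

Section relative_entropy.
Variables (G : lfgraph) (R : realType) (d : R).
Hypothesis curvG : nonneg_ollivier_ricci G R.
Hypothesis degG : forall z : vertex G, (deg z)%:R <= d.
Variables (t : R) (t0 : 0 < t).
Implicit Types (x y z : vertex G) (f g : vertex G -> R).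

Lemma measurable_vertex d' (T' : measurableType d') (F : vertex G -> T') :
  measurable_fun [set: vertex G] F.
Proof. by move=> _ Y mY. Qed.

Lemma heat_prob1 x z : heat_prob x t0 [set z] = (heat t x z)%:E.
Proof. by rewrite /heat_prob esum_set1// lee_fin heat_ge0. Qed.

(** An unordered sum is a supremum over finite sets, and over a finite set the
    sum is the integral of a simple function below [g]. *)
Lemma esum_le_integral x g : (forall z, 0 <= g z) ->
  (\esum_(z in [set: vertex G]) (heat t x z * g z)%:E
   <= \int[heat_prob x t0]_z (g z)%:E)%E.
Proof.
move=> g0; apply: ge_ereal_sup => _ [A [finA _] <-].
apply: (@le_trans _ _ (\int[heat_prob x t0]_z
    (\sum_(k \in A) ((g k)%:E * (\1_[set k] z)%:E)))%E); last first.
  apply: ge0_le_integral => //; try exact: measurable_vertex.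
  - by move=> z _; apply: fsume_ge0 => k _; rewrite -EFinM lee_fin mulr_ge0.
  move=> z _; have [zA|zA] := pselect (A z).
    rewrite (fsbigD1 z)//= fsbig1 ?adde0; last first.
      move=> k [Ak /= kz]; rewrite indicE memNset ?mule0// => zk.
      by apply: kz; rewrite zk.
    by rewrite indicE mem_set// mule1.
  rewrite fsbig1 ?lee_fin// => k Ak; rewrite indicE memNset ?mule0// => zk.
  by apply: zA; rewrite zk.
rewrite ge0_integral_fsum//; last first.
  by move=> k z _; rewrite -EFinM lee_fin mulr_ge0.
apply: lee_fsum => // k Ak.
rewrite ge0_integralZl//; last by rewrite lee_fin.
by rewrite integral_indic// setIT [X in (_ * X)%E]heat_prob1 -EFinM mulrC.
Qed.

(** The inequality between sums and integrals, applied to [g] and to [M - g], is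
    an equality because the total masses agree. *)
Lemma integral_heat M x g : (forall z, 0 <= g z <= M) ->
  (\int[heat_prob x t0]_z (g z)%:E = (semigroup t g x)%:E)%E.
Proof.
move=> gM; have g0 z : 0 <= g z by case/andP: (gM z).
have hM z : 0 <= M - g z <= M by have /andP[a b] := gM z; apply/andP; lra.
have h0 z : 0 <= M - g z by case/andP: (hM z).
have := esum_le_integral x g0; rewrite -(semigroup_heat t0 x gM) => ge.
have := esum_le_integral x h0; rewrite -(semigroup_heat t0 x hM) => he.
have : (\int[heat_prob x t0]_z (g z)%:E + \int[heat_prob x t0]_z (M - g z)%:E
    = M%:E)%E.
  rewrite -ge0_integralD//; try exact: measurable_vertex;
    [|by move=> z _; rewrite lee_fin..].
  transitivity (\int[heat_prob x t0]_z (cst M%:E z))%E.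
    by apply: eq_integral => z _; rewrite -EFinD subrKC.
  by rewrite integral_cst// [X in (_ * X)%E](heat_mass t0 x) mule1.
have := semigroupD t0 x gM hM.
rewrite (_ : (fun z => g z + (M - g z)) = fun=> M); last first.
  by apply/funext => z; rewrite subrKC.
rewrite semigroup_cst.
move: ge he; case: (\int[_]_z _)%E => [a||]; case: (\int[_]_z _)%E => [b||] //=.
rewrite !lee_fin => ge he SM /eqP; rewrite -EFinD eqe => /eqP ab.
by congr EFin; lra.
Qed.

Lemma heat_dominates x y : heat_prob x t0 `<< heat_prob y t0.
Proof.
move=> A yA B mB BA; suff -> : B = set0 by rewrite measure0.
apply/seteqP; split=> // z Bz; have := yA [set z] I.
rewrite heat_prob1 => zA0; suff : (heat t y z)%:E = 0%E.
  by move=> [] /eqP; rewrite gt_eqF// heat_gt0.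
by apply: zA0 => _ ->; exact: BA.
Qed.

(** The density is determined at every point, and not only almost everywhere,
    because every singleton has positive mass. *)
Lemma Radon_Nikodym_heat x y z :
  Radon_Nikodym (charge_of_finite_measure (heat_prob x t0)) (heat_prob y t0) z
  = (heat t x z / heat t y z)%:E.
Proof.
set nu := charge_of_finite_measure _; set r := Radon_Nikodym _ _ z.
have dom : nu `<< heat_prob y t0 := @heat_dominates x y.
have rfin : r \is a fin_num by exact: Radon_Nikodym_fin_num.
have : (heat t x z)%:E = (\int[heat_prob y t0]_(v in [set z])
    Radon_Nikodym nu (heat_prob y t0) v)%E.
  by rewrite -(heat_prob1 x z); exact: (Radon_Nikodym_integral (A := [set z]) dom).
rewrite (eq_integral (cst r)); last by move=> v; rewrite inE => ->.
rewrite integral_cst// [X in (_ = _ * X)%E]heat_prob1.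
rewrite -(fineK rfin) -EFinM => -[->]; congr EFin.
by rewrite mulfK// gt_eqF// heat_gt0.
Qed.

(** With [l] the logarithm of the density, the integral of the negative part of
    [l] may be assumed finite, for otherwise the entropy is [-oo], as
    [z - +oo = -oo].  Truncation of [l] to [[- L, n]] is undone first in [L],
    where the error is [exp (- L)], and then in [n] by monotone convergence. *)
Lemma log_harnack_rel_entropy x y :
  (rel_entropy (heat_prob x t0) (heat_prob y t0) <=
   (penalty d t (gdist x y)%:R)%:E)%E.
Proof.
rewrite /rel_entropy; case: asboolP => [_|/(_ (@heat_dominates x y))//].
pose l z := ln (heat t x z / heat t y z).
have r0 z : 0 < heat t x z / heat t y z by rewrite divr_gt0// heat_gt0.
rewrite (eq_integral (EFin \o l)); last first.
  by move=> z _; rewrite Radon_Nikodym_heat lne_EFin.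
set P := penalty _ _ _; rewrite integralE.
set mu := heat_prob x t0.
have [Ny|] := eqVneq (\int[mu]_z ((EFin \o l)^\- z))%E +oo%E.
  by rewrite Ny addeC /= leNye.
set N := (\int[mu]_z ((EFin \o l)^\- z))%E => Ny.
have N0 : (0 <= N)%E by apply: integral_ge0.
have Nfin : N \is a fin_num by rewrite ge0_fin_numE// ltey.
rewrite leeBlDr//.
pose lp n z := Num.min (Num.max (l z) 0) n%:R.
have lp0 n z : 0 <= lp n z by rewrite le_min le_max lexx orbT /=.
suff bound n : (\int[mu]_z (lp n z)%:E <= P%:E + N)%E.
  have -> : (\int[mu]_z ((EFin \o l)^\+ z) =
      limn (fun n => \int[mu]_z (lp n z)%:E))%E.
    rewrite -monotone_convergence//.
    - apply: eq_integral => z _; rewrite funeposE /=; apply/esym/lim_near_cst => //.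
      near=> n; rewrite -EFin_max /lp; congr EFin; apply/min_idPl.
      by near: n; exact: nbhs_infty_ger.
    - by move=> n z _; rewrite lee_fin.
    - move=> z _ m n mn; rewrite lee_fin /lp le_min !ge_min lexx ler_nat mn.
      by rewrite orbT.
  apply: lime_le; last exact: nearW.
  apply: ereal_nondecreasing_is_cvgn => m n mn.
  apply: ge0_le_integral => //; try exact: measurable_vertex.
    by move=> z _; rewrite lee_fin.
  by move=> z _; rewrite lee_fin /lp le_min !ge_min lexx ler_nat mn orbT.
apply/lee_addgt0Pr => e e0.
pose L := e^-1; have L0 : 0 < L by rewrite invr_gt0.
pose g z := Num.max (Num.min (l z) n%:R) (- L) + L.
have gM z : 0 <= g z <= n%:R + L.
  apply/andP; split; first by rewrite -lerBlDr sub0r le_max lexx orbT.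
  rewrite lerD2r ge_max ge_min lexx orbT /=.
  by apply: (@le_trans _ _ 0) => //; rewrite oppr_le0 ltW.
have H := log_harnack_semigroup curvG degG x y t0 gM; rewrite -/P in H.
have eg1 z : 0 < expR (g z) <= expR (n%:R + L).
  by rewrite expR_gt0 ler_expR; case/andP: (gM z).
have eg z : 0 <= expR (g z) <= expR (n%:R + L).
  by have /andP[/ltW -> ->] := eg1 z.
have S0 := semigroup_gt0 t0 y eg1.
set S := semigroup t (fun z => expR (g z)) y in H S0.
have S1 : S <= expR L + 1.
  rewrite -lee_fin (semigroup_heat t0 y eg).
  (* The truncated density is at most the density plus [exp (- L)], and the
     density integrates to 1. *)
  apply: (@le_trans _ _ (\esum_(z in [set: vertex G])
      ((expR L)%:E * (heat t x z)%:E + (heat t y z)%:E))%E).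
    apply: le_esum => z _; rewrite -EFinM -EFinD lee_fin.
    apply: (@le_trans _ _ (heat t y z * (expR L * (heat t x z / heat t y z) + 1))).
      rewrite ler_wpM2l ?heat_ge0// /g expRD.
      have [_|_] := leP (Num.min (l z) n%:R) (- L).
        by rewrite -expRD addrC subrr expR0 lerDr mulr_ge0 ?expR_ge0// ltW.
      rewrite ler_wpDr// mulrC ler_wpM2l ?expR_ge0//.
      by rewrite -[leRHS]lnK ?posrE// ler_expR ge_min lexx.
    rewrite le_eqVlt; apply/orP; left; apply/eqP; field.
    by rewrite gt_eqF// heat_gt0.
  rewrite esumD; first last.
  - by move=> z _; rewrite lee_fin heat_ge0.
  - by move=> z _; rewrite mule_ge0// lee_fin ?expR_ge0 ?heat_ge0.
  rewrite esumZl ?expR_ge0//; last by move=> z; rewrite lee_fin heat_ge0.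
  by rewrite !heat_mass// mule1.
have lnS : ln S <= L + e.
  apply: (@le_trans _ _ (ln (expR L + 1))).
    by rewrite ler_ln ?posrE ?addr_gt0 ?expR_gt0.
  apply: le_trans (ln_add_le (expR_gt0 L) ler01) _.
  by rewrite expRK lerD2l mul1r -expRN expRN_le.
have : (\int[mu]_z (lp n z)%:E + L%:E <= (L + e + P)%:E + N)%E.
  apply: (@le_trans _ _ ((semigroup t g x)%:E + N)%E); last first.
    by apply: leeD2r; rewrite lee_fin; lra.
  rewrite -(integral_heat x gM) -/mu /N -ge0_integralD//;
    try exact: measurable_vertex; last first.
    by move=> z _; rewrite lee_fin; case/andP: (gM z).
  have -> : (L%:E = \int[mu]_z (cst L%:E z))%E.
    by rewrite integral_cst// [X in (_ * X)%E](heat_mass t0 x) mule1.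
  rewrite -ge0_integralD//; try exact: measurable_vertex; first last.
  - by move=> z _; rewrite lee_fin ltW.
  - by move=> z _; rewrite lee_fin.
  apply: ge0_le_integral => //; try exact: measurable_vertex.
    by move=> z _; rewrite -EFinD lee_fin addr_ge0// ltW.
  move=> z _; rewrite funenegE /= -EFin_max -!EFinD lee_fin.
  rewrite /g addrAC lerD2r /lp; have [lz|lz] := leP 0 (l z).
    rewrite [X in _ + X]max_r ?oppr_le0// addr0.
    by rewrite le_max lexx.
  rewrite [X in _ + X]max_l ?oppr_ge0 ?(ltW lz)//.
  rewrite (min_l (ler0n _ _)) -lerBlDr sub0r opprK.
  by rewrite (min_l (le_trans (ltW lz) (ler0n _ _))) le_max lexx.
rewrite -(fineK Nfin); case: (\int[_]_z _)%E => [a||] //=.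
  by rewrite -!EFinD !lee_fin; lra.
by move=> _; exact: leNye.
Unshelve. all: by end_near. Qed.

End relative_entropy.

Theorem theorem2p6 (R : realType) (G : lfgraph) (d : R)
    (curvG : nonneg_ollivier_ricci G R)
    (degG : forall z : vertex G, (deg z)%:R <= d) :
  (forall (x y : vertex G) (t : R) (t_gt0 : 0 < t),
    (rel_entropy (heat_prob x t_gt0) (heat_prob y t_gt0) <=
     (32 * d * ((gdist x y)%:R ^+ 2 / t + (gdist x y)%:R / Num.sqrt t))%:E)%E)
  /\
  (forall f : vertex G -> R, (forall z, 0 < f z) ->
    (exists M : R, forall z, f z <= M) ->
    forall (x y : vertex G) (t : R), 0 < t ->
    (heat_op t (fun z => ln (f z)) x <=
     lne (heat_op t f y) +
     (32 * d * ((gdist x y)%:R ^+ 2 / t + (gdist x y)%:R / Num.sqrt t))%:E)%E).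
Proof.
split=> [x y t t0|f f0 [M fM] x y t t0].
  exact: (log_harnack_rel_entropy curvG degG t0 x y).
exact: (log_harnack_heat_op curvG degG x y t0 f0 fM).
Qed.
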